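(* Assume that $c^n$ satisfies $c_m\le c^n\le c_M$ almost everywhere in $\Omega$, where $0<c_m\le c_M$ and $\beta c_M\le\epsilon_0<1$, and that $\lambda>0$ satisfies $$\lambda\geq \frac{\epsilon_0}{(1-\epsilon_0)^2}+\left(\frac{\epsilon_0^2}{(1-\epsilon_0)^4}-2\ln(1-\epsilon_0)\frac{\epsilon_0}{(1-\epsilon_0)^2}\right)^{1/2}.$$ Let $c^{n+1}\in H^1(\Omega)$, together with the constant $\mu_e^{n+1}\in\mathbb R$, be the (weak) solution of the semi-implicit time-discrete scheme $$\frac{1}{\tau}(c^{n+1}-c^n)-\kappa\Delta c^{n+1}+\nu(c^n)c^{n+1}=s_r(c^n)+\mu_e^{n+1}\ \text{ in }\Omega,\qquad \int_\Omega c^{n+1}\,dx=c_t,\qquad \nabla c^{n+1}\cdot \mathbf n_{\partial\Omega}=0\ \text{ on }\partial\Omega .$$ If $$\max_{c_m\le c\le c_M}\bigl(c_m\nu(c)-s_r(c)\bigr)\le \mu_e^{n+1}\le \min_{c_m\le c\le c_M}\bigl(c_M\nu(c)-s_r(c)\bigr),$$ then $c_m\le c^{n+1}\le c_M$ almost everywhere in $\Omega$.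
   Context: $\Omega$ is a bounded, connected, smooth domain in $\mathbb R^d$ with outward unit normal $\mathbf n_{\partial\Omega}$. The constants $\tau>0$ (time step size), $\kappa>0$, $c_t>0$ (total moles), $\vartheta_0\in\mathbb R$, $R>0$, $T>0$ are given. The Peng-Robinson parameters are $\alpha=\alpha(T)=0.45724\frac{R^2T_c^2}{P_c}[1+m(1-\sqrt{T/T_c})]^2$ and $\beta=0.07780\frac{RT_c}{P_c}>0$, where $T_c,P_c>0$ are the critical temperature and pressure and $m$ is a real number determined by the acentric factor $\omega$: $m=0.37464+1.54226\omega-0.26992\omega^2$ if $\omega\le0.49$, and $m=0.379642+1.485030\omega-0.164423\omega^2+0.016666\omega^3$ if $\omega>0.49$. For $c\in[c_m,c_M]$ define $$G(c)=\sqrt{\lambda c-c\ln(1-\beta c)},\qquad \nu(c)=RT\Bigl(\frac1c+G'(c)^2\Bigr),$$ $$\mu_{\rm attraction}(c)=\frac{\alpha}{2\sqrt2\,\beta}\ln\Bigl(\frac{1+(1-\sqrt2)\beta c}{1+(1+\sqrt2)\beta c}\Bigr)-\frac{\alpha c}{1+2\beta c-(\beta c)^2},$$ $$s_r(c)=-\vartheta_0-RT\ln(c)+RT\bigl(G'(c)^2c-2G(c)G'(c)+\lambda\bigr)-\mu_{\rm attraction}(c).$$ Weak solution means: $c^{n+1}\in H^1(\Omega)$ and $\mu_e^{n+1}\in\mathbb R$ (constant in space, part of the unknowns) satisfy $\int_\Omega c^{n+1}dx=c_t$ and, for all $w\in H^1(\Omega)$, $\frac1\tau(c^{n+1}-c^n,w)+\kappa(\nabla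 c^{n+1},\nabla w)+(\nu(c^n)c^{n+1},w)=(s_r(c^n)+\mu_e^{n+1},w)$, with $(\cdot,\cdot)$ the $L^2(\Omega)$ inner product. *)

(* Defs.v *)
From HB Require Import structures.
From mathcomp Require Import all_boot all_order all_algebra.
From mathcomp Require Import all_classical all_reals all_analysis.

Set Implicit Arguments.
Unset Strict Implicit.
Unset Printing Implicit Defensive.

Import Order.TTheory GRing.Theory Num.Theory.
Import numFieldNormedType.Exports.

Local Open Scope classical_set_scope.
Local Open Scope ring_scope.

Definition measure_rV_display : measure_display.
Proof. exact: default_measure_display. Qed.

(* Since R is second countable, the product sigma-algebra below is the Borel
   sigma-algebra of R^d. *)
Section measurable_rV.
Context {R : realType} {d : nat}.

Definition rV_coord (i : 'I_d) (x : 'rV[R]_d) : measurableTypeR R := x 0 i.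

Let rV_set0 : g_sigma_preimage rV_coord set0.
Proof. exact: sigma_algebra0. Qed.

Let rV_setC A : g_sigma_preimage rV_coord A -> g_sigma_preimage rV_coord (~` A).
Proof. exact: sigma_algebraC. Qed.

Let rV_bigcup (F : _^nat) : (forall i, g_sigma_preimage rV_coord (F i)) ->
  g_sigma_preimage rV_coord (\bigcup_i (F i)).
Proof. exact: sigma_algebra_bigcup. Qed.

HB.instance Definition _ := @isMeasurable.Build measure_rV_display
  'rV[R]_d (g_sigma_preimage rV_coord) rV_set0 rV_setC rV_bigcup.

Lemma measurable_rV_coord (i : 'I_d) : measurable_fun setT (rV_coord i).
Proof.
move=> _ Y mY; rewrite setTI; apply: sub_sigma_algebra => /=.
rewrite -bigcup_seq/=; exists i => /=; first by rewrite mem_index_enum.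
by exists Y => //; rewrite setTI.
Qed.

Lemma measurable_fun_rVP d1 (T1 : measurableType d1) (f : T1 -> 'rV[R]_d) :
  (forall i, measurable_fun setT (rV_coord i \o f)) -> measurable_fun setT f.
Proof.
move=> mf.
have G : g_sigma_preimage (fun i => rV_coord i \o f) `<=` measurable.
  apply: smallest_sub; first exact: sigma_algebra_measurable.
  rewrite -bigcup_seq/=; apply: bigcup_sub => i _ A [B mB <-].
  exact: mf.
by move=> _ A mA; apply: G; rewrite g_sigma_preimage_comp; exists A.
Qed.

End measurable_rV.

Section lebesgue_rV.
Context {R : realType}.

Definition cons_rV d (p : measurableTypeR R * 'rV[R]_d) : 'rV[R]_d.+1 :=
  \row_i if unlift 0 i is Some j then p.2 0 j else p.1.

Lemma measurable_cons_rV d : measurable_fun setT (@cons_rV d).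
Proof.
apply: measurable_fun_rVP => i; case: (unliftP 0 i) => [j ->|->].
- rewrite (_ : _ \o _ = rV_coord j \o snd).
    by apply: measurableT_comp; [exact: measurable_rV_coord|].
  by apply/funext => p; rewrite /= /rV_coord mxE liftK.
- rewrite (_ : _ \o _ = fst)//.
  by apply/funext => p; rewrite /= /rV_coord mxE unlift_none.
Qed.

Definition uncons_rV d (x : 'rV[R]_d.+1) : measurableTypeR R * 'rV[R]_d :=
  (x 0 0, \row_j x 0 (lift 0 j)).

Lemma cons_rVK d : cancel (@cons_rV d) (@uncons_rV d).
Proof.
move=> [a y]; rewrite /uncons_rV /cons_rV/= mxE unlift_none; congr (_, _).
by apply/rowP => j; rewrite !mxE liftK.
Qed.

Lemma measurable_uncons_rV d : measurable_fun setT (@uncons_rV d).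
Proof.
apply: measurable_fun_pair; first exact: (measurable_rV_coord 0).
apply: measurable_fun_rVP => i.
rewrite (_ : _ \o _ = rV_coord (lift 0 i)); first exact: measurable_rV_coord.
by apply/funext => x; rewrite /= /rV_coord mxE.
Qed.

Section lebesgue_cons.
Local Open Scope ereal_scope.
Variables (d : nat) (mu : {sigma_finite_measure set 'rV[R]_d -> \bar R}).

Definition lebesgue_cons : set 'rV[R]_d.+1 -> \bar R :=
  pushforward (@lebesgue_measure R \x mu) (@cons_rV d).

Let lebesgue_cons0 : lebesgue_cons set0 = 0.
Proof. by rewrite /lebesgue_cons /pushforward preimage_set0 measure0. Qed.

Let lebesgue_cons_ge0 A : 0 <= lebesgue_cons A.
Proof. exact: (measure_ge0 (@lebesgue_measure R \x mu)). Qed.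

Let lebesgue_cons_sigma_additive : semi_sigma_additive lebesgue_cons.
Proof.
move=> F mF tF mUF; rewrite /lebesgue_cons /pushforward preimage_bigcup.
apply: (@measure_semi_sigma_additive _ _ _ (@lebesgue_measure R \x mu)).
- by move=> n; rewrite -[X in measurable X]setTI; exact: measurable_cons_rV.
- apply/trivIsetP => /= i j _ _ ij; rewrite -preimage_setI.
  by move/trivIsetP : tF => /(_ _ _ _ _ ij) ->//; rewrite preimage_set0.
- rewrite -preimage_bigcup -[X in measurable X]setTI.
  exact: measurable_cons_rV.
Qed.

HB.instance Definition _ := isMeasure.Build _ _ _ lebesgue_cons
  lebesgue_cons0 lebesgue_cons_ge0 lebesgue_cons_sigma_additive.

Let lebesgue_cons_sigma_finite : sigma_finite setT lebesgue_cons.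
Proof.
have /sigma_finiteP[F [TF ndF Foo]] := sigma_finiteT (@lebesgue_measure R).
have /sigma_finiteP[G [TG ndG Goo]] := sigma_finiteT mu.
exists (fun n => @uncons_rV d @^-1` (F n `*` G n)).
  apply/esym; rewrite -subTset => x _.
  have [n _ Fn] : (\bigcup_n F n) (uncons_rV x).1 by rewrite -TF.
  have [k _ Gk] : (\bigcup_n G n) (uncons_rV x).2 by rewrite -TG.
  exists (maxn n k) => //; split.
  - by apply: (subsetPset _ _ (ndF _ _ (leq_maxl n k))).
  - by apply: (subsetPset _ _ (ndG _ _ (leq_maxr n k))).
move=> n; have [mF Fn] := Foo n; have [mG Gn] := Goo n; split.
  rewrite -[X in measurable X]setTI; apply: measurable_uncons_rV => //.
  exact: measurableX.
rewrite /lebesgue_cons /pushforward -comp_preimage (_ : _ \o _ = id).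
  by rewrite preimage_id product_measure1E// lte_mul_pinfty// ge0_fin_numE.
exact/funext/cons_rVK.
Qed.

HB.instance Definition _ := Measure_isSigmaFinite.Build _ _ _ lebesgue_cons
  lebesgue_cons_sigma_finite.

End lebesgue_cons.

Fixpoint lebesgue_rV d : {sigma_finite_measure set 'rV[R]_d -> \bar R} :=
  match d with
  | 0%N => \d_(0 : 'rV[R]_0)
  | d'.+1 => lebesgue_cons (lebesgue_rV d')
  end.

Lemma lebesgue_rV_box d (A : 'I_d -> set (measurableTypeR R)) :
  (forall i, measurable (A i)) ->
  lebesgue_rV d [set x | forall i, A i (rV_coord i x)] =
  (\prod_(i < d) lebesgue_measure (A i))%E.
Proof.
elim: d A => [|d IH] A mA.
  rewrite big_ord0 /= diracE (_ : _ \in _ = true)//.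
  by apply/mem_set => -[].
have mB : measurable [set y : 'rV[R]_d | forall i, A (lift 0 i) (rV_coord i y)].
  rewrite (_ : mkset _ =
      \big[setI/setT]_(i < d) (rV_coord i @^-1` A (lift 0 i))); last first.
    rewrite -bigcap_seq; apply/seteqP; split => [y Ay i _|y Ay i]; first exact: Ay.
    by apply: (Ay i); rewrite /= mem_index_enum.
  apply: bigsetI_measurable => i _; rewrite -[X in measurable X]setTI.
  exact: measurable_rV_coord.
rewrite big_ord_recl -(IH (fun i => A (lift 0 i)))// -product_measure1E//.
rewrite /= /lebesgue_cons /pushforward; congr ((_ \x _)%E _).
apply/seteqP; split => [[a y] Aay|[a y] [Aa Ay] i] /=.
  split; first by have := Aay 0; rewrite /rV_coord mxE unlift_none.
  by move=> i; have := Aay (lift 0 i); rewrite /rV_coord mxE liftK.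
rewrite /rV_coord mxE; case: unliftP => [j|] -> //; exact: Ay.
Qed.

End lebesgue_rV.

Section sobolev.
Context {R : realType} {d : nat}.
Local Notation Rd := 'rV[R]_d.
Implicit Types (O : set Rd) (u v w : Rd -> R) (g h : 'I_d -> Rd -> R).

Definition partial (i : 'I_d) (f : Rd -> R) : Rd -> R := 'D_(delta_mx 0 i) f.

Fixpoint is_Ck (k : nat) (f : Rd -> R) : Prop :=
  match k with
  | 0%N => continuous f
  | k'.+1 => continuous f /\
      forall i, (forall x, derivable f x (delta_mx 0 i)) /\ is_Ck k' (partial i f)
  end.

Definition smooth (f : Rd -> R) : Prop := forall k, is_Ck k f.

(* Near each boundary point, O is the sublevel set of a smooth local defining
   function with nonvanishing gradient at that point. *)
Definition smooth_boundary O : Prop :=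
  forall x, (closure O `\` interior O) x ->
    exists (U : set Rd) (rho : Rd -> R),
      [/\ nbhs x U, smooth rho, (exists i, partial i rho x != 0)
        & forall y, U y -> O y <-> rho y < 0].

Definition smooth_bounded_domain O : Prop :=
  [/\ O !=set0, open O, connected O, bounded_set O & smooth_boundary O].

Definition test_function O (phi : Rd -> R) : Prop :=
  smooth phi /\
  exists K : set Rd, [/\ compact K, K `<=` O & forall x, ~ K x -> phi x = 0].

Definition inner O u v : R := \int[lebesgue_rV d]_(x in O) (u x * v x).

Definition inner_grad O g h : R := \sum_(i < d) inner O (g i) (h i).

Definition L2 O u : Prop :=
  measurable_fun O u /\
  (lebesgue_rV d).-integrable O (fun x => (u x ^+ 2)%:E).

Definition weak_partial O (i : 'I_d) u v : Prop :=
  forall phi, test_function O phi ->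
    inner O u (partial i phi) = - inner O v phi.

(* u belongs to H^1(O) with weak gradient g, which is unique up to equality
   almost everywhere. *)
Definition H1_grad O u g : Prop :=
  L2 O u /\ forall i, L2 O (g i) /\ weak_partial O i u (g i).

End sobolev.

Section peng_robinson.
Context {R : realType}.
Implicit Types Rgas temp Tc Pc omega alpha beta lambda c : R.

Definition pr_m omega : R :=
  if omega <= 49 / 100 then
    37464%N%:R / 10 ^+ 5 + 154226%N%:R / 10 ^+ 5 * omega
    - 26992%N%:R / 10 ^+ 5 * omega ^+ 2
  else
    379642%N%:R / 10 ^+ 6 + 1485030%N%:R / 10 ^+ 6 * omega
    - 164423%N%:R / 10 ^+ 6 * omega ^+ 2 + 16666%N%:R / 10 ^+ 6 * omega ^+ 3.

Definition pr_alpha Rgas temp Tc Pc omega : R :=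
  45724%N%:R / 10 ^+ 5 * (Rgas ^+ 2 * Tc ^+ 2 / Pc)
  * (1 + pr_m omega * (1 - Num.sqrt (temp / Tc))) ^+ 2.

Definition pr_beta Rgas Tc Pc : R := 778 / 10 ^+ 4 * (Rgas * Tc / Pc).

Definition G_fun beta lambda c : R :=
  Num.sqrt (lambda * c - c * ln (1 - beta * c)).

Definition nu_fun Rgas temp beta lambda c : R :=
  Rgas * temp * (c^-1 + derive1 (G_fun beta lambda) c ^+ 2).

Definition mu_attraction alpha beta c : R :=
  alpha / (2 * Num.sqrt 2 * beta)
    * ln ((1 + (1 - Num.sqrt 2) * beta * c) / (1 + (1 + Num.sqrt 2) * beta * c))
  - alpha * c / (1 + 2 * beta * c - (beta * c) ^+ 2).

Definition sr_fun Rgas temp alpha beta lambda vartheta c : R :=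
  - vartheta - Rgas * temp * ln c
  + Rgas * temp * (derive1 (G_fun beta lambda) c ^+ 2 * c
      - 2 * G_fun beta lambda c * derive1 (G_fun beta lambda) c + lambda)
  - mu_attraction alpha beta c.

End peng_robinson.

(* The homogeneous Neumann condition is the natural condition of this weak form. *)
Definition weak_solution (R : realType) (d : nat) (O : set 'rV[R]_d)
    (tau kappa ct : R) (nu sr : R -> R) (cn cn1 : 'rV[R]_d -> R) (mue : R) :
    Prop :=
  exists g : 'I_d -> 'rV[R]_d -> R,
    [/\ H1_grad O cn1 g,
      \int[lebesgue_rV d]_(x in O) cn1 x = ct
      & forall w h, H1_grad O w h ->
        tau^-1 * inner O (cn1 \- cn) w + kappa * inner_grad O g h
          + inner O (fun x => nu (cn x) * cn1 x) w
        = inner O (fun x => sr (cn x) + mue) w].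

(* Main.v *)
Require Import Defs.
From HB Require Import structures.
From mathcomp Require Import all_boot all_order all_algebra.
From mathcomp Require Import all_classical all_reals all_analysis.
From mathcomp Require Import ring lra finmap measurable_realfun.

Set Implicit Arguments.
Unset Strict Implicit.
Unset Printing Implicit Defensive.

Import Order.TTheory GRing.Theory Num.Theory.
Import numFieldNormedType.Exports.

Local Open Scope classical_set_scope.
Local Open Scope ring_scope.

(* Test the weak equation with w = F(sigma (c^{n+1} - c)), where (sigma, c) is
   (1, c_M) or (-1, c_m) and F is a smoothed positive part. The gradient term has a
   sign because F is nondecreasing, and the hypotheses on mu_e say that the constant c
   is a super- resp. subsolution, so what remains is
   int sigma (c^{n+1} - c) F(sigma (c^{n+1} - c)) <= 0 with a nonnegative integrand.

   That w is an admissible test function is the chain rule for F(u), u in H^1. It is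
   obtained without mollification. Testing with bump functions converging to
   indicators of boxes gives, locally and for almost every x,
   u(x) - u(x - h e_i) = int_0^h (d_i u)(x - s e_i) ds; hence difference quotients of u
   are bounded in L^2 by d_i u, and if F' is bounded and Lipschitz the difference
   quotient form of the chain rule holds up to an error O(h). *)

(** * Borel sets and Lebesgue measure on row vectors *)

(** Why differences suffice: the increment of F(u) over a step h is F'(u) times the increment of u,
    up to a remainder quadratic in that increment. As increments of u are O(h) in L^2, the remainder
    is O(h^2) in L^1. Only fixed test functions are integrated against these quantities, so no
    pointwise limit of difference quotients is ever taken.

    The sign argument rests on writing u = c + (u - c) in the terms of order zero, where u =
    c^{n+1}: they equal (u - c) / tau + (c - c^n) / tau + nu (u - c) + (c nu - s_r - mu_e). After
    multiplication by sigma F(sigma (u - c)) every summand is nonnegative; the last one is where the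
    condition on mu_e enters.

    A separate obstacle is that c^n lies in [c_m, c_M] only almost everywhere, while the formulas
    for nu and s_r are controlled only on that interval. The coefficients are therefore composed
    with a retraction onto it, and the integrals of the scheme are shown to be unchanged without
    knowing that the original integrands are measurable. *)

Definition box (R : realType) d (a b : 'rV[R]_d) : set 'rV[R]_d :=
  [set x | forall i, a 0 i < x 0 i < b 0 i].

Section borel_rV.
Context {R : realType} {d : nat}.
Local Notation Rd := 'rV[R]_d.

Lemma measurable_coord_box (A : 'I_d -> set (measurableTypeR R)) :
  (forall i, measurable (A i)) -> measurable [set x : Rd | forall i, A i (x 0 i)].
Proof.
move=> mA.
rewrite (_ : mkset _ = \big[setI/setT]_(i < d) (rV_coord i @^-1` A i)).
  apply: bigsetI_measurable => i _; rewrite -[X in measurable X]setTI.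
  exact: measurable_rV_coord.
rewrite -bigcap_seq; apply/seteqP; split => [y Ay i _|y Ay i]; first exact: Ay.
by apply: (Ay i); rewrite /= mem_index_enum.
Qed.

Lemma measurable_box (a b : Rd) : measurable (box a b).
Proof.
rewrite (_ : box a b = [set x | forall i, `]a 0 i, b 0 i[%classic (x 0 i)]).
  exact: (@measurable_coord_box (fun i => `]a 0 i, b 0 i[%classic)).
by apply/seteqP; split => x xab i; have := xab i; rewrite /= in_itv.
Qed.

Definition boxes : set (set Rd) := [set B | exists a b, B = box a b].

Lemma boxesI : setI_closed boxes.
Proof.
move=> _ _ [a [b ->]] [a' [b' ->]].
exists (\row_i Num.max (a 0 i) (a' 0 i)), (\row_i Num.min (b 0 i) (b' 0 i)).
apply/seteqP; split => [x [h h'] i|x h]; rewrite ?mxE.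
  rewrite gt_max lt_min; have /andP[h1 h2] := h i; have /andP[h3 h4] := h' i.
  by apply/andP; split; apply/andP.
split => i; have := h i; rewrite !mxE gt_max lt_min.
  by move=> /andP[/andP[h1 _] /andP[h2 _]]; apply/andP.
by move=> /andP[/andP[_ h1] /andP[_ h2]]; apply/andP.
Qed.

Lemma bigcup_box : \bigcup_n box (const_mx (- n%:R)) (const_mx n%:R : Rd) = setT.
Proof.
apply/seteqP; split => // x _.
exists (Num.truncn `|x|).+1 => // i; rewrite !mxE -ltr_norml.
have := truncnS_gt `|x|; apply: le_lt_trans.
rewrite [leRHS]/Num.norm /= mx_normrE; apply/bigmax_geP; right => /=.
by exists (0, i).
Qed.

(** A slab restricting one coordinate to an open interval is a countable union of boxes whose other
    sides grow. Boxes thus form a generating pi-system, ready for measure uniqueness and Dynkin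
    arguments. *)
Lemma measurable_rVE : @measurable _ Rd = <<s boxes >>.
Proof.
apply/seteqP; split; last first.
  apply: smallest_sub; first exact: sigma_algebra_measurable.
  by move=> _ [a [b ->]]; exact: measurable_box.
rewrite {1}/measurable /=; apply: smallest_sub.
  exact: smallest_sigma_algebra.
rewrite -bigcup_seq; apply: bigcup_sub => i _ _ [A mA <-].
rewrite setTI.
have sI : sigma_algebra setT (image_set_system setT (@rV_coord R d i) <<s boxes >>).
  by apply: sigma_algebra_image; exact: smallest_sigma_algebra.
(* Change of generator on the line, from half-open to open intervals, to match the open boxes. *)
have {}mA : (@ocitv R).-sigma.-measurable A by exact: mA.
rewrite RGenOpens.measurableE in mA.
suff /(_ _ mA) : (@RGenOpens.G R).-sigma.-measurable `<=`
    image_set_system setT (@rV_coord R d i) <<s boxes >>.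
  by rewrite /image_set_system /= setTI.
apply: smallest_sub => // _ [x [y ->]]; rewrite /image_set_system /= setTI.
rewrite (_ : _ @^-1` _ = \bigcup_n box
   (\row_j if j == i then x else - n%:R) (\row_j if j == i then y else n%:R)).
  apply: sigma_algebra_bigcup => n; apply: sub_sigma_algebra.
  by eexists; eexists.
apply/seteqP; split => [z|z [n _ /(_ i)]]; last first.
  by rewrite /= /rV_coord in_itv !mxE eqxx.
rewrite /= in_itv /rV_coord /= => zxy.
have [n _ zn] : (\bigcup_n box (const_mx (- n%:R)) (const_mx n%:R : Rd)) z.
  by rewrite bigcup_box.
exists n => // j; rewrite !mxE; case: eqVneq => [->//|_].
by have := zn j; rewrite !mxE.
Qed.

(** Links the norm topology to the product sigma-algebra: an open set is the union of the balls it
    contains with rational centre and radius [1/(n+1)], and balls of the sup norm are boxes. *)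
Lemma open_measurable_rV (O : set Rd) : open O -> measurable O.
Proof.
move=> oO.
pose Q : set ('rV[rat]_d * nat) :=
  [set p | ball (map_mx ratr p.1 : Rd) p.2.+1%:R^-1 `<=` O].
rewrite (_ : O = \bigcup_(p in Q) ball (map_mx ratr p.1 : Rd) p.2.+1%:R^-1).
  rewrite bigcup_mkcond; apply: countable_bigcupT_measurable => // p.
  case: ifPn => // _.
  rewrite (_ : ball _ _ = [set x : Rd | forall i,
      `](map_mx ratr p.1 : Rd) 0 i - p.2.+1%:R^-1,
        (map_mx ratr p.1 : Rd) 0 i + p.2.+1%:R^-1[%classic (x 0 i)]).
    apply: (@measurable_coord_box (fun i =>
      `](map_mx ratr p.1 : Rd) 0 i - p.2.+1%:R^-1,
        (map_mx ratr p.1 : Rd) 0 i + p.2.+1%:R^-1[%classic)) => i.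
    exact: measurable_itv.
  apply/seteqP; split => x /=.
    move=> [_ h] i; have := h 0 i; rewrite ball_itv /= in_itv /=; exact.
  move=> h; split; first by rewrite invr_gt0.
  by move=> i j; rewrite ord1; have := h j; rewrite ball_itv /= in_itv.
apply/seteqP; split => [x Ox|x [p]]; last by move=> Qp; exact: Qp.
have /nbhs_ballP[e /= e0 xeO] : nbhs x O by exact: open_nbhs_nbhs.
have [n ne] : exists n : nat, n.+1%:R^-1 < e / 2.
  exists (Num.truncn (2 / e)).
  rewrite invf_plt ?posrE ?divr_gt0// invf_div.
  exact: truncnS_gt.
have [q qx] : {q : 'rV[rat]_d & forall i, ball (ratr (q 0 i) : R) n.+1%:R^-1 (x 0 i)}.
  have h i : {q : rat | ball (ratr q : R) n.+1%:R^-1 (x 0 i)}.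
    apply: cid.
    have /rat_in_itvoo[q] : x 0 i - n.+1%:R^-1 < x 0 i + n.+1%:R^-1.
      by rewrite ltrBlDr -addrA ltrDl addr_gt0 ?invr_gt0.
    move=> qx; exists q; apply: ball_sym; rewrite ball_itv; exact: qx.
  by exists (\row_i sval (h i)) => i; rewrite mxE; exact: (svalP (h i)).
have qx' : ball (map_mx ratr q : Rd) n.+1%:R^-1 x.
  by split; [rewrite invr_gt0|move=> i j; rewrite ord1 mxE; exact: qx].
exists (q, n) => // y /= qy; apply: xeO.
apply: (@le_ball _ _ _ (n.+1%:R^-1 + n.+1%:R^-1)).
  by rewrite [leRHS]splitr lerD// ltW.
by apply: ball_triangle qy; exact: ball_sym.
Qed.

Lemma continuous_measurable_rV (f : Rd -> R) :
  continuous f -> measurable_fun setT f.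
Proof.
move=> cf; apply: (measurability _ (RGenOpens.measurableE R)).
move=> _ [_ [x [y ->]] <-]; rewrite setTI; apply: open_measurable_rV.
by apply: open_comp => [z _|]; [exact: cf|exact: interval_open].
Qed.

Definition translate (v x : Rd) : Rd := x + v.

Lemma measurable_translate v : measurable_fun setT (translate v).
Proof.
apply: measurable_fun_rVP => i.
rewrite (_ : _ \o _ = (fun x => rV_coord i x + v 0 i)); last first.
  by apply/funext => x; rewrite /= /rV_coord !mxE.
by apply: measurable_funD => //; exact: measurable_rV_coord.
Qed.

Lemma box_translate v a b : translate v @^-1` box a b = box (a - v) (b - v).
Proof.
apply/seteqP; split => x /= h i; have := h i; rewrite !mxE.
  by rewrite ltrBlDr ltrBrDr.
by rewrite ltrBlDr ltrBrDr.
Qed.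

Lemma lebesgue_rV_boxE (a b : Rd) : lebesgue_rV d (box a b) =
  (\prod_(i < d) (if (a 0 i < b 0 i)%R then (b 0 i - a 0 i)%:E else 0))%E.
Proof.
rewrite (_ : box a b =
    [set x | forall i, (fun i => `]a 0 i, b 0 i[%classic) i (rV_coord i x)]).
  rewrite (lebesgue_rV_box (A := fun i => `]a 0 i, b 0 i[%classic))//;
    apply: eq_bigr => i _.
  by rewrite lebesgue_measure_itv /= lte_fin.
by apply/seteqP; split => x /= h i; have := h i; rewrite /= in_itv.
Qed.

Lemma lebesgue_rV_box_lty (a b : Rd) : (lebesgue_rV d (box a b) < +oo)%E.
Proof.
rewrite lebesgue_rV_boxE.
have : forall r, (\prod_(i <- r) (if (a 0 i < b 0 i)%R then (b 0 i - a 0 i)%:E else 0))%E \is a @fin_num R.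
  move=> r; elim/big_ind : _ => // [x y xf yf|i _]; first by rewrite fin_numM.
  by case: ifP.
by move=> /(_ (index_enum _)) /fin_numPlt /andP[].
Qed.

(** The measure and its translate agree on the pi-system of boxes, and boxes of finite measure
    exhaust the space. *)
Lemma lebesgue_rV_translate v A : measurable A ->
  lebesgue_rV d (translate v @^-1` A) = lebesgue_rV d A.
Proof.
move=> mA; have mt := measurable_translate v.
rewrite -[LHS]/(pushforward (lebesgue_rV d) (translate v) A).
apply/esym.
apply: (measure_unique boxes (fun n => box (const_mx (- n%:R)) (const_mx n%:R : Rd))) => //.
- exact: measurable_rVE.
- exact: boxesI.
- by move=> i; eexists; eexists.
- exact: bigcup_box.
- move=> _ [a [b ->]]; 
  transitivity (lebesgue_rV d (box (a - v) (b - v))); last by rewrite -box_translate.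
  etransitivity; first exact: lebesgue_rV_boxE.
  rewrite lebesgue_rV_boxE.
  by apply: eq_bigr => i _; rewrite !mxE ltrD2r opprB addrA subrK.
- by move=> k; exact: lebesgue_rV_box_lty.
Qed.

End borel_rV.

Section integral_translate.
Context {R : realType} {d : nat}.
Local Notation Rd := 'rV[R]_d.
Local Notation mu := (lebesgue_rV d).

Lemma ge0_integral_translate (v : Rd) (f : Rd -> \bar R) :
  measurable_fun setT f -> (forall x, 0 <= f x)%E ->
  (\int[mu]_x f (translate v x) = \int[mu]_x f x)%E.
Proof.
move=> mf f0; have mt := @measurable_translate R d v.
rewrite -[LHS]/(\int[mu]_(x in translate v @^-1` setT) (f \o translate v) x)%E.
rewrite -ge0_integral_pushforward//.
apply: eq_measure_integral => A mA _; exact: lebesgue_rV_translate.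
Qed.

Lemma integrable_translate (v : Rd) (f : Rd -> \bar R) :
  mu.-integrable setT f -> mu.-integrable setT (fun x => f (translate v x)).
Proof.
move=> /integrableP[mf foo]; apply/integrableP; split.
  by apply: (measurableT_comp mf); exact: measurable_translate.
rewrite (ge0_integral_translate v (f := fun x => `|f x|%E))//.
exact: measurableT_comp.
Qed.

(** Positive and negative parts are translated separately, so measurability of [f] is enough. *)
Lemma Rintegral_translate (v : Rd) (f : Rd -> R) :
  measurable_fun setT f ->
  \int[mu]_x f (translate v x) = \int[mu]_x f x.
Proof.
move=> mf; rewrite /Rintegral; congr fine.
have mF : measurable_fun setT (EFin \o f) by exact/measurable_EFinP.
rewrite integralE [in RHS]integralE; congr (_ - _)%E.
- transitivity (\int[mu]_x (EFin \o f)^\+%E (translate v x))%E;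
  first by apply: eq_integral => x _; rewrite ?funeposE ?funenegE.
  by apply: ge0_integral_translate => //; exact: measurable_funepos.
- transitivity (\int[mu]_x (EFin \o f)^\-%E (translate v x))%E;
  first by apply: eq_integral => x _; rewrite ?funeposE ?funenegE.
  by apply: ge0_integral_translate => //; exact: measurable_funeneg.
Qed.

End integral_translate.

(** * Smooth test functions *)

Section flat.
Context {R : realType}.
Implicit Types (p : {poly R}) (t : R).

(* The family [flat p] is closed under differentiation: see [is_derive_flat]. *)
Definition flat p t : R := if 0 < t then p.[t^-1] * expR (- t^-1) else 0.

(** The exponential series absorbs each monomial: with y = 1/t, y^(i+1) is at most (i+1)! exp y, and
    the spare factor y leaves the factor |t|. *)
Lemma flat_le p : exists2 C, 0 <= C & forall t, `|flat p t| <= C * `|t|.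
Proof.
exists (\sum_(i < size p) `|p`_i| * i.+1`!%:R).
  by apply: sumr_ge0 => i _; rewrite mulr_ge0.
move=> t; rewrite /flat; case: ifPn => [t0|_]; last first.
  by rewrite normr0 mulr_ge0// sumr_ge0// => i _; rewrite mulr_ge0.
rewrite horner_coef !mulr_suml (le_trans (ler_norm_sum _ _ _))//.
apply: ler_sum => i _; rewrite -!mulrA normrM ler_wpM2l//.
have y0 : 0 < t^-1 by rewrite invr_gt0.
have := expR_ge1Dxn i (ltW y0).
rewrite ger0_norm ?mulr_ge0 ?exprn_ge0 ?expR_ge0 ?(ltW y0)// gtr0_norm// => h.
rewrite expRN ler_pdivrMr ?expR_gt0//.
have {}h : t^-1 ^+ i.+1 <= (i.+1)`!%:R * expR t^-1.
  rewrite mulrC -ler_pdivrMr ?ltr0n ?fact_gt0//; apply: le_trans h.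
  by rewrite lerDr.
have -> : t^-1 ^+ i = t * t^-1 ^+ i.+1.
  by rewrite exprS mulrA divff ?mul1r// gt_eqF.
by rewrite mulrAC [leRHS]mulrC ler_wpM2l// ltW.
Qed.

Lemma is_derive_flat p t : is_derive t 1 (flat p) (flat ('X^2 * (p - p^`())) t).
Proof.
have [t0|t0|->] := ltgtP t 0.
- rewrite {2}/flat ltNge (ltW t0)/=.
  apply: (@near_eq_is_derive _ _ _ (cst 0)).
  by near=> s; rewrite /flat ifN// -leNgt ltW//; near: s; exact: lt_nbhsl.
- pose g := fun s : R => p.[s^-1] * expR (- s^-1).
  apply: (@near_eq_is_derive _ _ _ g).
    by near=> s; rewrite /flat ifT//; near: s; exact: lt_nbhsr.
  have t0' : t != 0 by rewrite gt_eqF.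
  have dV : is_derive t (1:R) (fun s : R => s^-1) (- t ^- 2 *: 1).
    exact: is_deriveV.
  have d1 := @is_derive1_comp _ (horner p) (fun s : R => s^-1) t _ _ (is_derive_poly p t^-1) dV.
  have d2 := @is_derive1_comp _ expR (fun s : R => - s^-1) t _ _ (is_derive_expR (- t^-1)) (is_deriveN dV).
  have := is_deriveM d1 d2.
  move/(@is_derive_eq _ _ _ _ _ _ _ _); apply.
  rewrite /flat t0 !hornerE /GRing.scale /= exprVn; ring.
- rewrite {2}/flat ltxx.
  (* At the origin the difference quotient [flat p h / h] is [flat ('X * p) h], which the linear
     bound sends to 0. *)
  have [C C0 hC] := flat_le ('X * p).
  have hD : (fun h : R => h^-1 *: (flat p (h *: 1 + 0) - flat p 0)) @ 0^' --> (0:R).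
    apply/cvgr0Pnorm_le => e e0.
    near=> h.
    have h0 : h != 0 by near: h; exact: nbhs_dnbhs_neq.
    rewrite [X in `|X|](_ : _ = flat ('X * p) h); last first.
      rewrite /flat ltxx subr0 addr0 /GRing.scale /= mulr1.
      by case: ifPn => [hp|]; rewrite ?mulr0// hornerM hornerX mulrA.
    apply: (le_trans (hC h)).
    rewrite -[leLHS](_ : (C + 1) * `|h| - `|h| = _); last by ring.
    rewrite lerBlDr (@le_trans _ _ e)// ?lerDl//.
    rewrite -ler_pdivlMl ?ltr_wpDl//.
    near: h; apply: dnbhs0_le; by rewrite mulr_gt0 ?invr_gt0 ?ltr_wpDl.
  split; [apply/cvg_ex; by exists 0|exact: cvg_lim].
Unshelve. all: by end_near. Qed.

Lemma flat1_ge0 t : 0 <= flat 1 t.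
Proof. by rewrite /flat; case: ifP => // _; rewrite hornerC mul1r expR_ge0. Qed.

Lemma flat1_le1 t : flat 1 t <= 1.
Proof.
rewrite /flat; case: ifP => // t0; rewrite hornerC mul1r -expR0 ler_expR.
by rewrite oppr_le0 invr_ge0 ltW.
Qed.

Lemma flat1_cvg t : flat 1 (n%:R * t) @[n --> \oo] --> ((0 < t)%R%:R : R).
Proof.
have [t0|t0] := ltP 0 t; last first.
  rewrite (_ : (fun _ => _) = cst 0); first exact: cvg_cst.
  by apply/funext => n; rewrite /flat ifN// -leNgt mulr_ge0_le0.
rewrite (_ : true%:R = expR (- (0 * t^-1))); last by rewrite mul0r oppr0 expR0.
(* The shift avoids [n = 0], where [flat] takes its zero branch and the exponential formula
   fails. *)
rewrite -cvg_shiftS /=.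
rewrite (_ : (fun _ => _) = (fun n : nat => expR (- (n.+1%:R^-1 * t^-1)))).
  apply: continuous_cvg; first exact: continuous_expR.
  apply: cvgN; apply: cvgM; last exact: cvg_cst.
  exact: cvg_harmonic.
by apply/funext => n; rewrite /flat ifT ?mulr_gt0// hornerC mul1r invfM.
Qed.

End flat.

(** Directional derivatives become one-variable derivatives along a line, where the chain rule, the
    mean value theorem and the fundamental theorem of calculus apply. *)
Lemma is_derive_lineP (R : realType) (V : normedModType R) (f : V -> R) x v df :
  is_derive x v f df <-> is_derive (0:R) (1:R) (fun h : R => f (h *: v + x)) df.
Proof.
have E : 'D_v f x = 'D_1 (fun h : R => f (h *: v + x)) 0.
  rewrite /derive; set F := (fun h => _); set G := (fun h => _ (f _ - _)).
  suff -> : F = G by []; apply/funext => h; rewrite /F /G /=.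
  by rewrite scale0r add0r addr0 /GRing.scale /= mulr1.
split=> -[h <-].
  by split; [exact: (derivable1P f x v).1|rewrite E].
by split; [exact: (derivable1P f x v).2|rewrite E].
Qed.

Lemma is_derive_line (R : realType) d (f : 'rV[R]_d -> R) (v x : 'rV[R]_d) (s : R) :
  derivable f (x + s *: v) v ->
  is_derive s 1 (fun s => f (x + s *: v)) ('D_v f (x + s *: v)).
Proof.
move=> /derivableP /is_derive_lineP df.
apply/is_derive_lineP.
rewrite (_ : (fun _ => _) = (fun h : R => f (h *: v + (x + s *: v))))//.
apply/funext => h; congr f.
by rewrite scalerDl -[h *: 1]/(h * 1) mulr1 addrCA.
Qed.

Section is_Ck_lemmas.
Context {R : realType} {d : nat}.
Local Notation Rd := 'rV[R]_d.
Implicit Types f g : Rd -> R.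

Lemma is_CkW k f : is_Ck k.+1 f -> is_Ck k f.
Proof.
elim: k f => [f []//|k IH f [cf df]]; split => // i.
by have [d1 d2] := df i; split => //; exact: IH.
Qed.

Lemma is_Ck_cont k f : is_Ck k f -> continuous f.
Proof. by case: k => //= k []. Qed.

Lemma is_Ck_cst k (c : R) : is_Ck k (fun _ : Rd => c).
Proof.
elim: k c => [c|k IH c]; first exact: cst_continuous.
split; first exact: cst_continuous.
move=> i; split; first by move=> x; exact: derivable_cst.
rewrite (_ : partial i _ = fun=> 0)//; apply/funext => x.
exact: (derive_cst c).
Qed.

Lemma is_CkD k f g : is_Ck k f -> is_Ck k g -> is_Ck k (f \+ g).
Proof.
elim: k f g => [f g cf cg x|k IH f g [cf df] [cg dg]].
  exact: (cvgD (cf x) (cg x)).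
split=> [x|i]; first exact: (cvgD (cf x) (cg x)).
have [df1 df2] := df i; have [dg1 dg2] := dg i.
split=> [x|]; first exact: derivableD.
rewrite (_ : partial i _ = partial i f \+ partial i g); first exact: IH.
by apply/funext => x; exact: deriveD.
Qed.

Lemma is_CkM k f g : is_Ck k f -> is_Ck k g -> is_Ck k (f \* g).
Proof.
elim: k f g => [f g cf cg x|k IH f g].
  exact: (cvgM (cf x) (cg x)).
move=> Cf Cg; have := is_CkW Cf; have := is_CkW Cg.
move: Cf Cg => [cf df] [cg dg] Ckg Ckf.
split=> [x|i]; first exact: (cvgM (cf x) (cg x)).
have [df1 df2] := df i; have [dg1 dg2] := dg i.
split=> [x|]; first exact: derivableM.
rewrite (_ : partial i _ = (f \* partial i g) \+ (g \* partial i f)).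
  by apply: is_CkD; exact: IH.
by apply/funext => x; rewrite /partial deriveM.
Qed.

Lemma is_Ck_prod k (I : Type) (r : seq I) (F : I -> Rd -> R) :
  (forall i, is_Ck k (F i)) -> is_Ck k (fun x => \prod_(i <- r) F i x).
Proof.
move=> CF; elim: r => [|i r IH].
  rewrite (_ : (fun _ => _) = fun=> 1); first exact: is_Ck_cst.
  by apply/funext => x; rewrite big_nil.
rewrite (_ : (fun _ => _) = F i \* (fun x => \prod_(i <- r) F i x)).
  by apply: is_CkM; [exact: CF|exact: IH].
by apply/funext => x; rewrite big_cons.
Qed.

(** The induction on [k] runs over all polynomials at once: a partial derivative is a constant times
    the same expression for another polynomial. *)
Lemma is_Ck_flat k p (a b : R) j :
  is_Ck k (fun x : Rd => flat p (a * x 0 j + b)).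
Proof.
have cflat p' : continuous (fun x : Rd => flat p' (a * x 0 j + b)).
  move=> x; apply: (@continuous_comp _ _ _ (fun x : Rd => a * x 0 j + b) (flat p')).
    apply: (@continuousD _ _ _ (fun x : Rd => a * x 0 j) (fun=> b));
      last exact: cst_continuous.
    by apply: (@continuousM _ _ (fun=> a) (fun x : Rd => x 0 j));
      [exact: cst_continuous|exact: coord_continuous].
  apply/differentiable_continuous/derivable1_diffP.
  by have [] := is_derive_flat p' (a * x 0 j + b).
elim: k p => [p|k IH p]; first exact: cflat.
split=> // i.
have dF x : is_derive x (delta_mx 0 i) (fun x : Rd => flat p (a * x 0 j + b))
    (flat ('X^2 * (p - p^`())) (a * x 0 j + b) * (a * (i == j)%:R)).
  apply/is_derive_lineP.
  pose g (h : R) : R := a * (i == j)%:R * h + (a * x 0 j + b).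
  rewrite (_ : (fun _ => _) = flat p \o g); last first.
    apply/funext => h; rewrite /g /= !mxE eqxx /= eq_sym; congr flat.
    by ring.
  apply: is_derive1_comp.
    rewrite (_ : a * x 0 j + b = g 0); first exact: is_derive_flat.
    by rewrite /g mulr0 add0r.
  rewrite /g; apply: is_derive_eq.
  by rewrite addr0 /GRing.scale /= mulr1.
split=> [x|]; first by have [] := dF x.
rewrite (_ : partial i _ = (fun x => flat ('X^2 * (p - p^`())) (a * x 0 j + b)) \*
   (fun=> (a * (i == j)%:R))).
  by apply: is_CkM; [exact: IH|exact: is_Ck_cst].
by apply/funext => x; have [] := dF x.
Qed.

End is_Ck_lemmas.

(** * Smooth bump functions on boxes *)

Section box_bump.
Context {R : realType} {d : nat}.
Local Notation Rd := 'rV[R]_d.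
Implicit Types (a b x : Rd) (n : nat).

Definition cbox a b : set Rd := [set x | forall i, a 0 i <= x 0 i <= b 0 i].

Lemma compact_cbox a b : compact (cbox a b).
Proof.
rewrite (_ : cbox a b = [set x | forall i, (fun i => `[a 0 i, b 0 i]%classic) i (x 0 i)]).
  by apply: (@rV_compact R d (fun i => `[a 0 i, b 0 i]%classic)) => i;
    exact: segment_compact.
by apply/seteqP; split => x xab i; have := xab i; rewrite /= in_itv.
Qed.

(** One flat factor per face: the function vanishes off the open box, and as [n] grows it tends to
    the indicator of that box. Translating it amounts to translating the corners. *)
Definition box_bump n a b x : R :=
  \prod_i (flat 1 (n%:R * (x 0 i - a 0 i)) * flat 1 (n%:R * (b 0 i - x 0 i))).

Lemma box_bump_smooth n a b : smooth (box_bump n a b).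
Proof.
move=> k; apply: is_Ck_prod => i.
apply: (@is_CkM _ _ _ (fun x => flat 1 (n%:R * (x 0 i - a 0 i)))
                      (fun x => flat 1 (n%:R * (b 0 i - x 0 i)))).
  rewrite (_ : (fun _ => _) = fun x : Rd => flat 1 (n%:R * x 0 i + (- n%:R * a 0 i))).
    exact: is_Ck_flat.
  by apply/funext => x; congr flat; ring.
rewrite (_ : (fun _ => _) = fun x : Rd => flat 1 (- n%:R * x 0 i + n%:R * b 0 i)).
  exact: is_Ck_flat.
by apply/funext => x; congr flat; ring.
Qed.

Lemma box_bump_ge0 n a b x : 0 <= box_bump n a b x.
Proof. by apply: prodr_ge0 => i _; rewrite mulr_ge0 ?flat1_ge0. Qed.

Lemma box_bump_le1 n a b x : box_bump n a b x <= 1.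
Proof.
apply: numdomain.Num.Theory.prodr_ile1 => i _.
by rewrite mulr_ge0 ?flat1_ge0// mulr_ile1 ?flat1_ge0 ?flat1_le1.
Qed.

Lemma box_bump_eq0 n a b x : ~ box a b x -> box_bump n a b x = 0.
Proof.
move=> nx; apply/eqP; apply: contra_notT nx => /prodf_neq0 h i.
have := h i isT; rewrite mulf_eq0 negb_or => /andP[].
have fl t : flat 1 (n%:R * t) != 0 -> 0 < t.
  rewrite /flat; case: ifPn => [+ _|]; last by rewrite eqxx.
  by case: n {h} => [|n]; rewrite ?mul0r ?ltxx ?pmulr_rgt0.
by move=> /fl + /fl; rewrite !subr_gt0 => -> ->.
Qed.

Lemma box_bump_cvg a b x : box_bump n a b x @[n --> \oo] --> (\1_(box a b) x : R).
Proof.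
rewrite (_ : \1_(box a b) x = \prod_i ((0 < x 0 i - a 0 i)%R%:R * (0 < b 0 i - x 0 i)%R%:R)).
  rewrite /box_bump; elim: (index_enum _) => [|i r IH].
    rewrite big_nil (_ : (fun _ => _) = cst 1); first exact: cvg_cst.
    by apply/funext => n; rewrite big_nil.
  rewrite big_cons (_ : (fun _ => _) = fun n =>
      flat 1 (n%:R * (x 0 i - a 0 i)) * flat 1 (n%:R * (b 0 i - x 0 i)) *
      \prod_(i <- r) (flat 1 (n%:R * (x 0 i - a 0 i)) * flat 1 (n%:R * (b 0 i - x 0 i)))).
    by apply: cvgM IH; apply: cvgM; exact: flat1_cvg.
  by apply/funext => n; rewrite big_cons.
rewrite indicE;
  case: (boolP (x \in _)) => [/set_mem xab|/negP/(contra_not mem_set) xab].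
  rewrite big1// => i _; have /andP[h1 h2] := xab i.
  by rewrite !subr_gt0 h1 h2 mulr1.
apply/esym/eqP; apply: contra_notT xab => /prodf_neq0 h i.
have := h i isT; rewrite !subr_gt0.
by case: (_ < _); case: (_ < _); rewrite ?mulr0 ?mul0r ?eqxx.
Qed.

Lemma box_bump_translate n a b v x : box_bump n a b (x + v) = box_bump n (a - v) (b - v) x.
Proof.
by apply: eq_bigr => i _; rewrite !mxE; congr (flat 1 _ * flat 1 _); ring.
Qed.

Lemma box_bump_test n a b (O : set Rd) : cbox a b `<=` O ->
  test_function O (box_bump n a b).
Proof.
move=> abO; split; first exact: box_bump_smooth.
exists (cbox a b); split => // [|x nx]; first exact: compact_cbox.
apply: box_bump_eq0; apply: contra_not nx => xab i.
by have /andP[h1 h2] := xab i; rewrite !ltW.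
Qed.

End box_bump.

(** * Compactly supported functions and their increments along an axis *)

Section compact_support.
Context {R : realType} {d : nat}.
Local Notation Rd := 'rV[R]_d.
Implicit Types (f : Rd -> R) (K : set Rd).

Lemma compact_support_bounded f K : continuous f -> compact K ->
  (forall x, ~ K x -> f x = 0) -> exists2 M, 0 <= M & forall x, `|f x| <= M.
Proof.
move=> cf cK f0.
have [K0|/set0P K0] := eqVneq K set0.
  by exists 0 => // x; rewrite f0 ?normr0// K0.
have cnf : {within K, continuous (fun x => `|f x|)}.
  apply: continuous_subspaceT => x; apply: continuous_comp; first exact: cf.
  exact: norm_continuous.
have [c Kc hc] := EVT_max_rV K0 cK cnf.
exists `|f c| => // x; have [Kx|nK] := pselect (K x); first exact/hc/mem_set.
by rewrite f0// normr0.
Qed.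

Lemma compact_closed_rV K : compact K -> closed K.
Proof. by apply: compact_closed; exact: norm_hausdorff. Qed.

Lemma partial_support f K i : compact K ->
  (forall x, ~ K x -> f x = 0) -> forall x, ~ K x -> partial i f x = 0.
Proof.
move=> cK f0 x nKx; rewrite /partial -(derive_cst (0 : R) (delta_mx 0 i) x).
apply: near_eq_derive.
have oK : open (~` K) by apply: closed_openC; exact: compact_closed_rV.
have : nbhs x (~` K) by exact: open_nbhs_nbhs.
by apply: filterS => y /= /f0.
Qed.

Lemma partial_translate f i v x :
  partial i (fun y => f (y + v)) x = partial i f (x + v).
Proof.
rewrite /partial /derive; set F := (fun h => _); set G := (fun h => _ (f _ - _)).
by suff -> : F = G by []; apply/funext => h; rewrite /F /G /= addrA.
Qed.

Lemma FTC_line f i x h : 0 < h -> (forall y, derivable f y (delta_mx 0 i)) ->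
  continuous (partial i f) ->
  f (x + h *: delta_mx 0 i) - f x =
  \int[lebesgue_measure]_(s in `[0, h]) partial i f (x + s *: delta_mx 0 i).
Proof.
move=> h0 df cf.
have dF s := is_derive_line (df (x + s *: delta_mx 0 i)).
have cF : continuous (fun s : R => partial i f (x + s *: delta_mx 0 i)).
  move=> s; apply: (continuous_comp (f := fun s : R => x + s *: delta_mx 0 i));
    last exact: cf.
  apply: (@continuousD _ _ _ (fun=> x) (fun s : R => s *: delta_mx 0 i)).
    exact: cst_continuous.
  exact: scalel_continuous.
have dcF : continuous (fun s : R => f (x + s *: delta_mx 0 i)).
  by move=> s; apply/differentiable_continuous/derivable1_diffP; have [] := dF s.
rewrite /Rintegral (@continuous_FTC2 _ _ (fun s => f (x + s *: delta_mx 0 i)))//.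
- by rewrite /= scale0r addr0.
- exact: continuous_subspaceT.
- split.
  + by move=> s _; have [] := dF s.
  + by apply: cvg_at_right_filter; exact: dcF.
  + by apply: cvg_at_left_filter; exact: dcF.
- by move=> s _; rewrite derive1E; have [_ ->] := dF s.
Qed.

Lemma lipschitz_line f i M : (forall y, derivable f y (delta_mx 0 i)) ->
  (forall y, `|partial i f y| <= M) ->
  forall x h, 0 <= h -> `|f (x + h *: delta_mx 0 i) - f x| <= M * h.
Proof.
move=> df hM x h h0.
have dF s := is_derive_line (df (x + s *: delta_mx 0 i)).
have [|s _] := @MVT_segment R (fun s => f (x + s *: delta_mx 0 i)) _ _ _ h0 (fun s _ => dF s).
  apply: continuous_subspaceT => s.
  by apply/differentiable_continuous/derivable1_diffP; have [] := dF s.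
rewrite /= scale0r addr0 subr0 => ->.
by rewrite normrM (ger0_norm h0) ler_wpM2r//; exact: hM.
Qed.

(** The mean value theorem gives the increment as [h] times the derivative at an intermediate point,
    which [lipschitz_line] compares with the derivative at [x]. *)
Lemma taylor_line f i M : (forall y, derivable f y (delta_mx 0 i)) ->
  (forall y, derivable (partial i f) y (delta_mx 0 i)) ->
  (forall y, `|partial i (partial i f) y| <= M) ->
  forall x h, 0 <= h ->
    `|f (x + h *: delta_mx 0 i) - f x - h * partial i f x| <= M * h ^+ 2.
Proof.
move=> df ddf hM x h h0.
have dF s := is_derive_line (df (x + s *: delta_mx 0 i)).
have [|s] := @MVT_segment R (fun s => f (x + s *: delta_mx 0 i)) _ _ _ h0 (fun s _ => dF s).
  apply: continuous_subspaceT => s.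
  by apply/differentiable_continuous/derivable1_diffP; have [] := dF s.
rewrite in_itv /= scale0r addr0 subr0 => /andP[s0 sh] ->.
rewrite [X in X - _]mulrC -mulrBr normrM (ger0_norm h0).
rewrite (_ : M * h ^+ 2 = h * (M * h)); last by ring.
rewrite ler_wpM2l//; apply: le_trans (lipschitz_line ddf hM x s0) _.
by rewrite ler_wpM2l// (le_trans _ (hM x)).
Qed.

End compact_support.

(** * Weak derivatives and difference quotients *)

Section fubini_real.
Context d1 d2 (T1 : measurableType d1) (T2 : measurableType d2) (R : realType).
Variable m1 : {sigma_finite_measure set T1 -> \bar R}.
Variable m2 : {sigma_finite_measure set T2 -> \bar R}.
Variable f : T1 * T2 -> R.
Hypothesis intf : (m1 \x m2)%E.-integrable setT (EFin \o f).

Lemma integrable_fine d (T : measurableType d) (m : {measure set T -> \bar R})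
    (F : T -> \bar R) :
  m.-integrable setT F -> m.-integrable setT (EFin \o (fine \o F)).
Proof.
move=> iF; apply: (le_integrable _ _ _ iF) => //.
  by apply/measurable_EFinP; apply: measurableT_comp => //; exact: measurable_int iF.
move=> x _ /=; case: (F x) => [r| |]//=; rewrite ?normr0 ?leey//.
Qed.

(** Inner integrals in Fubini's theorem are finite only almost everywhere; [fine] sends the infinite
    values to 0 on a null set, so real-valued iterated integrals keep their value. *)
Lemma Rintegral_fine d (T : measurableType d) (m : {measure set T -> \bar R})
    (F : T -> \bar R) :
  m.-integrable setT F -> (\int[m]_x (fine (F x))%:E = \int[m]_x F x)%E.
Proof.
move=> iF; apply: ae_eq_integral => //.
- exact: measurable_int (integrable_fine iF).
- exact: measurable_int iF.
- have := integrable_ae measurableT iF; apply: filterS => x /= /(_ I) fx _.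
  by rewrite fineK.
Qed.

Let integrable_G : m2.-integrable setT (fubini_G m1 (EFin \o f)).
Proof.
have mf : measurable_fun setT (EFin \o f) by exact: measurable_int intf.
apply/integrableP; split; first exact: (measurable_fubini_G intf).
apply: (@le_lt_trans _ _ (\int[m2]_y \int[m1]_x `|(f (x, y))%:E|))%E; last first.
  exact: ((integrable21ltyP m1 m2 mf).1 intf).
apply: ge0_le_integral => //.
- apply: measurableT_comp => //; exact: (measurable_fubini_G intf).
- apply: (measurable_fun_fubini_tonelli_G (abse \o (EFin \o f))).
    exact: measurableT_comp.
  by move=> p; exact: abse_ge0.
- move=> y _; apply: le_abse_integral => //.
  by apply: (measurableT_comp mf); exact: pair2_measurable.
Qed.

Lemma integrable_fubini1 :
  m1.-integrable setT (EFin \o (fun x => \int[m2]_y f (x, y))).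
Proof. exact: (integrable_fine (integrable_fubini_F intf)). Qed.

Lemma integrable_fubini2 :
  m2.-integrable setT (EFin \o (fun y => \int[m1]_x f (x, y))).
Proof. exact: (integrable_fine integrable_G). Qed.

Lemma Rintegral_fubini :
  \int[m1]_x (\int[m2]_y f (x, y)) = \int[m2]_y (\int[m1]_x f (x, y)).
Proof.
rewrite /Rintegral; congr fine.
rewrite (Rintegral_fine (integrable_fubini_F intf)).
rewrite (Rintegral_fine integrable_G).
by rewrite (integral12_prod_meas1 intf) (integral21_prod_meas1 intf).
Qed.

End fubini_real.

Section shear.
Context {R : realType} {d : nat}.
Local Notation Rd := 'rV[R]_d.
Local Notation mu := (lebesgue_rV d).
Local Notation leb := (@lebesgue_measure R).

Lemma measurable_shear (v : Rd) :
  measurable_fun setT (fun p : measurableTypeR R * Rd => p.2 + (p.1 : R) *: v).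
Proof.
apply: measurable_fun_rVP => i.
rewrite (_ : _ \o _ = (fun p => rV_coord i p.2 + (p.1 : R) * v 0 i)); last first.
  by apply/funext => x; rewrite /= /rV_coord !mxE.
apply: measurable_funD.
  by apply: measurableT_comp => //; exact: measurable_rV_coord.
by apply: measurable_funM => //; exact: measurable_fst.
Qed.

(** For fixed [s], translation invariance bounds the inner integral by [C] times the L^1 norm of
    [F], uniformly in [s]; the strip of width [h] makes the total finite. This licenses every
    exchange of an integral along a direction with an integral over space. *)
Lemma integrable_shear (v : Rd) (h C : R) (b : measurableTypeR R * Rd -> R) (F : Rd ->
  R) :
  0 <= h -> measurable_fun setT b -> (forall p, `|b p| <= C) ->
  mu.-integrable setT (EFin \o F) ->
  (leb \x mu)%E.-integrable setT
    (EFin \o (fun p : measurableTypeR R * Rd =>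
      \1_`[0, h] p.1 * (b p * F (p.2 + (p.1 : R) *: v)))).
Proof.
move=> h0 mb bC iF.
have mF : measurable_fun setT F by apply/measurable_EFinP; exact: measurable_int iF.
have C0 : 0 <= C by apply: le_trans (bC (0, 0)).
have mf : measurable_fun setT (fun p : measurableTypeR R * Rd =>
      \1_`[0, h] p.1 * (b p * F (p.2 + (p.1 : R) *: v))).
  apply: measurable_funM;
    first by apply: (measurableT_comp (f := \1_`[0, h] : measurableTypeR R -> R)).
  apply: measurable_funM => //.
  apply: (measurableT_comp mF). exact: measurable_shear.
apply/integrable12ltyP; first exact/measurable_EFinP.
pose N : \bar R := (\int[mu]_x `|F x|%:E)%E.
have N0 : (0 <= N)%E by exact: integral_ge0.
have Noo : (N < +oo)%E by have /integrableP[_] := iF.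
apply: (@le_lt_trans _ _ (\int[leb]_s (C%:E * N * (\1_`[0, h] s)%:E)))%E.
  apply: ge0_le_integral => //.
  - by move=> s _; exact: integral_ge0.
  - apply: (measurable_fun_fubini_tonelli_F (abse \o (EFin \o _))).
      by apply: measurableT_comp => //; exact/measurable_EFinP.
    by move=> p; exact: abse_ge0.
  - apply: emeasurable_funM => //; apply/measurable_EFinP; exact: measurable_indic.
  - move=> s _.
    have mFs : measurable_fun setT (fun x : Rd => `|F (translate (s *: v) x)|).
      apply: measurableT_comp => //; apply: (measurableT_comp mF).
      exact: measurable_translate.
    have <- : (\int[mu]_x (`|F (translate (s *: v) x)|%:E) = N)%E.
      apply: (ge0_integral_translate (s *: v) (f := fun x => `|F x|%:E)) => //.
      by apply/measurable_EFinP; apply: measurableT_comp.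
    rewrite muleAC -EFinM -ge0_integralZl//; last 2 first.
    + exact/measurable_EFinP.
    + by rewrite lee_fin mulr_ge0// indicE.
    apply: ge0_le_integral => //.
    + apply: measurableT_comp => //; apply/measurable_EFinP.
      exact: (measurable_fun_pair2 s mf).
    + by apply: measurable_funeM; exact/measurable_EFinP.
    + move=> x _; rewrite /= lee_fin !normrM (ger0_norm (_ : 0 <= \1__ _)) ?indicE//.
      by rewrite mulrA ler_wpM2r// mulrC ler_wpM2r.
rewrite ge0_integralZl ?mule_ge0//; last first.
  by apply/measurable_EFinP; exact: measurable_indic.
rewrite integral_indic// setIT /= lebesgue_measure_itv.
have Nf : N \is a fin_num by rewrite ge0_fin_numE.
rewrite -(fineK Nf) -EFinM; case: ifP => _; last by rewrite mule0 ltry.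
by rewrite -EFinB -EFinM ltry.
Qed.

End shear.

Section real_integrals.
Context d (T : measurableType d) (R : realType).
Variable mu : {measure set T -> \bar R}.
Implicit Types f g : T -> R.

Lemma integrable_measurable f D :
  mu.-integrable D (EFin \o f) -> measurable_fun D f.
Proof. by move=> intf; apply/measurable_EFinP; exact: measurable_int intf. Qed.

Lemma integrable_bndM f g (C : R) : measurable_fun setT f ->
  (forall x, `|f x| <= C) -> mu.-integrable setT (EFin \o g) ->
  mu.-integrable setT (EFin \o (fun x => f x * g x)).
Proof.
move=> mf fC ig; have := @integrableMr _ _ _ mu setT measurableT f _ mf _ ig.
apply; exists C; split; first exact: num_real.
by move=> M CM x _; apply: le_trans (fC x) (ltW CM).
Qed.

Lemma integrable_le f g : measurable_fun setT f ->
  (forall x, `|f x| <= g x) -> mu.-integrable setT (EFin \o g) ->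
  mu.-integrable setT (EFin \o f).
Proof.
move=> mf fg ig; apply: (le_integrable measurableT _ _ ig).
  exact/measurable_EFinP.
by move=> x _; rewrite /= lee_fin (le_trans (fg x))// ler_norm.
Qed.

Lemma ae_eq_Rintegral f g : measurable_fun setT f -> measurable_fun setT g ->
  {ae mu, forall x, f x = g x} -> \int[mu]_x f x = \int[mu]_x g x.
Proof.
move=> mf mg fg; congr fine; apply: ae_eq_integral => //.
- exact/measurable_EFinP.
- exact/measurable_EFinP.
- by apply: filterS fg => x -> _.
Qed.

End real_integrals.

(** * Functions with vanishing integrals over boxes *)

Section fundamental_lemma.
Context {R : realType} {d : nat}.
Local Notation Rd := 'rV[R]_d.
Local Notation mu := (lebesgue_rV d).

(** Borel sets [A] over whose trace on the box [f] integrates to 0 form a Dynkin system; it contains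
    all boxes, hence all Borel sets. Closure under complement uses that the integral over the whole
    box is 0. *)
Lemma ae_eq0_boxes (a b : Rd) (f : Rd -> R) :
  mu.-integrable setT (EFin \o f) ->
  (forall a' b', \int[mu]_(x in box a' b' `&` box a b) (f x)%:E = 0)%E ->
  {ae mu, forall x, box a b x -> f x = 0}.
Proof.
move=> intf f0.
have mB := measurable_box a b.
have iS A : measurable A -> mu.-integrable A (EFin \o f).
  by move=> mA; apply: integrableS intf.
pose H : set (set Rd) := [set A | measurable A /\
  (\int[mu]_(x in A `&` box a b) (f x)%:E = 0)%E].
have dH : dynkin H.
  split.
  - by split => //; rewrite setTI -[X in integral _ X]setIid f0.
  - move=> A [mA A0]; split; first exact: measurableC.
    have mAB := measurableI _ _ mA mB.
    have mCB := measurableI _ _ (measurableC mA) mB.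
    have := f0 a b; rewrite setIid.
    rewrite -{1}(setTI (box a b)) -(setUv A) setIUl integral_setU//.
    + by rewrite A0 add0e.
    + by rewrite -setIUl setUv setTI; exact: measurable_int (iS _ mB).
    + by apply/disj_setPS; rewrite setIACA setICr set0I.
  - move=> F tF HF; split; first by apply: bigcupT_measurable => i; have [] := HF i.
    rewrite setI_bigcupl.
    rewrite integral_bigcup//.
    + rewrite eseries0// => i _ _; exact: (HF i).2.
    + exact: trivIset_setIr.
    + by move=> i; apply: measurableI => //; exact: (HF i).1.
    + by apply: iS; apply: bigcupT_measurable => i; apply: measurableI => //;
      exact: (HF i).1.
have sH : @measurable _ Rd `<=` H.
  rewrite measurable_rVE -(setI_closed_g_dynkin_g_sigma_algebra boxesI).
  apply: smallest_sub => //= _ [a' [b' ->]]; split; last exact: f0.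
  exact: measurable_box.
have : ae_eq mu (box a b) (EFin \o f) (cst 0%E).
  apply: integral_ae_eq => //; first exact: iS.
  move=> E EB mE; rewrite integral_cst// mul0e.
  by have [_] := sH _ mE; rewrite setIidl.
by apply: filterS => x h Bx; have := h Bx; rewrite /= => -[].
Qed.

End fundamental_lemma.

Lemma Rintegral_indic d (T : measurableType d) (R : realType)
    (mu : {measure set T -> \bar R}) (D : set T) (f : T -> R) :
  \int[mu]_(x in D) f x = \int[mu]_x (\1_D x * f x).
Proof.
rewrite Rintegral_mkcond; apply: eq_Rintegral => x _.
by rewrite patchE indicE; case: ifP => _; rewrite ?mul1r ?mul0r.
Qed.

(** * Increments of weakly differentiable functions *)

Section difference_quotient.
Context {R : realType} {d : nat}.
Local Notation Rd := 'rV[R]_d.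
Local Notation mu := (lebesgue_rV d).
Local Notation leb := (@lebesgue_measure R).
Variables (O : set Rd) (i : 'I_d) (U G : Rd -> R).
Local Notation e := (delta_mx 0 i : Rd).
Hypothesis iU : mu.-integrable setT (EFin \o U).
Hypothesis iG : mu.-integrable setT (EFin \o G).
Hypothesis weakUG : forall phi, test_function O phi ->
  \int[mu]_x (partial i phi x * U x) = - \int[mu]_x (phi x * G x).

Let mU : measurable_fun setT U := integrable_measurable iU.
Let mG : measurable_fun setT G := integrable_measurable iG.

(** Not divided by [h]: this is the candidate for the increment [U x - U (x - h *: e)], not for the
    difference quotient. *)
Definition line_average (h : R) (x : Rd) : R :=
  \int[leb]_s (\1_`[0, h] s * G (x - s *: e)).

Let integrable_shearG (h : R) (b : measurableTypeR R * Rd -> R) (C : R) : 0 <= h ->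
  measurable_fun setT b -> (forall p, `|b p| <= C) ->
  (leb \x mu)%E.-integrable setT
    (EFin \o (fun p : measurableTypeR R * Rd =>
      \1_`[0, h] p.1 * (b p * G (p.2 - (p.1 : R) *: e)))).
Proof.
move=> h0 mb bC; have := integrable_shear (- e) h0 mb bC iG.
by apply: eq_integrable => // p _; rewrite /= scalerN.
Qed.

Let integrable_shear0 (h : R) (b : measurableTypeR R * Rd -> R) (C : R) (F : Rd ->
  R) : 0 <= h ->
  measurable_fun setT b -> (forall p, `|b p| <= C) ->
  mu.-integrable setT (EFin \o F) ->
  (leb \x mu)%E.-integrable setT
    (EFin \o (fun p : measurableTypeR R * Rd => \1_`[0, h] p.1 * (b p * F p.2))).
Proof.
move=> h0 mb bC iF; have := integrable_shear 0 h0 mb bC iF.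
by apply: eq_integrable => // p _; rewrite /= scaler0 addr0.
Qed.

Lemma integrable_line_average h : 0 <= h ->
  mu.-integrable setT (EFin \o line_average h).
Proof.
move=> h0.
have c1 (p : measurableTypeR R * Rd) : `|(1 : R)| <= 1 by rewrite normr1.
have := integrable_fubini2 (@integrable_shearG h (fun=> 1) 1 h0 (measurable_cst _) c1).
apply: eq_integrable => // x _; rewrite /= /line_average.
by congr EFin; apply: eq_Rintegral => s _; rewrite mul1r.
Qed.

(** Fubini's theorem; [b x] enters the inner integral only for those [x] where that integral
    converges, which is almost everywhere. The weight [b] is later also a non-smooth function of
    [U]. *)
Lemma line_averageM h (b : Rd -> R) C : 0 <= h ->
  measurable_fun setT b -> (forall x, `|b x| <= C) ->
  \int[mu]_x (b x * line_average h x) =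
  \int[leb]_s (\1_`[0, h] s * \int[mu]_x (b x * G (x - s *: e))).
Proof.
move=> h0 mb bC.
have mb2 : measurable_fun setT (fun p : measurableTypeR R * Rd => b p.2).
  exact: measurableT_comp.
have bC2 (p : measurableTypeR R * Rd) : `|b p.2| <= C by [].
have c1 (p : measurableTypeR R * Rd) : `|(1 : R)| <= 1 by rewrite normr1.
have intf := integrable_shearG h0 mb2 bC2.
have int1 := @integrable_shearG h (fun=> 1) 1 h0 (measurable_cst _) c1.
transitivity (\int[mu]_x \int[leb]_s (\1_`[0, h] s * (b x * G (x - s *: e)))).
  apply: ae_eq_Rintegral.
  - apply: measurable_funM => //.
    exact: integrable_measurable (integrable_line_average h0).
  - exact: integrable_measurable (integrable_fubini2 intf).
  - have := ae_integrable2 int1; apply: filterS => x /= ix.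
    rewrite /line_average -RintegralZl//.
      by apply: eq_Rintegral => s _; rewrite mulrCA.
    by apply: eq_integrable ix => // s _; rewrite /= mul1r.
rewrite -(Rintegral_fubini intf).
apply: eq_Rintegral => s _ /=.
have ibG : mu.-integrable setT (EFin \o (fun x : Rd => b x * G (x - s *: e))).
  apply: integrable_bndM bC _ => //.
  exact: (integrable_translate (- (s *: e)) iG).
by rewrite RintegralZl.
Qed.

(** The increment of [psi] is the integral of its derivative over shifts [s] in [0, h], and for each
    [s] the weak identity is applied to the shifted [psi]. Hence every such shift has to be a test
    function in [O]. *)
Lemma weak_difference (psi : Rd -> R) (h : R) : 0 < h ->
  (forall s, 0 <= s <= h -> test_function O (fun x => psi (x + s *: e))) ->
  \int[mu]_x (psi x * (U x - U (x - h *: e))) =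
  \int[mu]_x (psi x * line_average h x).
Proof.
move=> h0 tpsi.
have [spsi [K [cK KO psi0]]] : test_function O psi.
  have := tpsi 0; rewrite lexx ltW// => /(_ isT).
  by congr test_function; apply/funext => x; rewrite scale0r addr0.
have cpsi := is_Ck_cont (spsi 0%N).
have [_ dpsi'] := spsi 1%N; have [dpsi cdpsi] := dpsi' i.
have [M0 M00 hM0] := compact_support_bounded cpsi cK psi0.
have [M1 M10 hM1] := compact_support_bounded cdpsi cK (partial_support i cK psi0).
have mpsi := continuous_measurable_rV cpsi.
have mdpsi := continuous_measurable_rV cdpsi.
have h0' := ltW h0.
have iUh : mu.-integrable setT (EFin \o (fun x => U (x - h *: e))).
  exact: (integrable_translate (- (h *: e)) iU).
have mpsih s : measurable_fun setT (fun x : Rd => psi (x + s *: e)).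
  by apply: (measurableT_comp mpsi); exact: measurable_translate.
(* Translation invariance moves the shift from [U] onto [psi]. *)
transitivity (- \int[mu]_x ((psi (x + h *: e) - psi x) * U x)).
  have -> : \int[mu]_x (psi x * (U x - U (x - h *: e))) =
      \int[mu]_x (psi x * U x) - \int[mu]_x (psi x * U (x - h *: e)).
    rewrite -RintegralB//; [|exact: integrable_bndM hM0 _..].
    by apply: eq_Rintegral => x _; rewrite mulrBr.
  have -> : \int[mu]_x (psi x * U (x - h *: e)) = \int[mu]_x (psi (x + h *: e) * U x).
    rewrite -(Rintegral_translate (- (h *: e)) (f := fun x => psi (x + h *: e) * U x)).
      by apply: eq_Rintegral => x _; rewrite /translate subrK.
    exact: measurable_funM.
  have iph : mu.-integrable setT (EFin \o (fun x : Rd => psi (x + h *: e) * U x)).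
    exact: (integrable_bndM (mpsih h) (fun x => hM0 (x + h *: e)) iU).
  rewrite -opprB -RintegralB//; last exact: integrable_bndM hM0 _.
  by congr (- _); apply: eq_Rintegral => x _; rewrite mulrBl.
rewrite (line_averageM h0' mpsi hM0).
have mb : measurable_fun setT (fun p : measurableTypeR R * Rd =>
    partial i psi (p.2 + (p.1 : R) *: e)).
  by apply: (measurableT_comp mdpsi); exact: measurable_shear.
have intf := integrable_shear0 h0' mb (fun p => hM1 _) iU.
transitivity (- \int[mu]_x \int[leb]_s (\1_`[0, h] s * (partial i psi (x + s *: e) * U x))).
  congr (- _); apply: eq_Rintegral => x _.
  rewrite (FTC_line x h0 dpsi cdpsi) Rintegral_indic -RintegralZr//.
    by apply: eq_Rintegral => s _; rewrite mulrA.
  have := integrable_bndM (measurable_fun_pair1 x mb) (fun s => hM1 _)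
    (integrable_indic_itv 0 h true false).
  by apply: eq_integrable => // s _; rewrite /= mulrC.
rewrite -(Rintegral_fubini intf) -mulN1r -RintegralZl//; last first.
  exact: (integrable_fubini1 intf).
apply: eq_Rintegral => s _.
have mdpsis : measurable_fun setT (fun x : Rd => partial i psi (x + s *: e)).
  by apply: (measurableT_comp mdpsi); exact: measurable_translate.
have -> : \int[mu]_x (\1_`[0, h] s * (partial i psi (x + s *: e) * U x)) =
    \1_`[0, h] s * \int[mu]_x (partial i psi (x + s *: e) * U x).
  by rewrite RintegralZl//; exact: (integrable_bndM mdpsis (fun x => hM1 _) iU).
rewrite indicE; case: (boolP (s \in _)) => [/set_mem|_]; last by rewrite !mul0r mulr0.
rewrite /= in_itv /= => sh; rewrite !mul1r.
have := weakUG (tpsi s sh).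
under eq_Rintegral do rewrite partial_translate.
move=> ->; rewrite mulN1r opprK.
rewrite -(Rintegral_translate (- (s *: e)) (f := fun x => psi (x + s *: e) * G x)).
  by apply: eq_Rintegral => x _; rewrite /translate subrK.
exact: measurable_funM.
Qed.

End difference_quotient.

Section difference_quotient_ae.
Context {R : realType} {d : nat}.
Local Notation Rd := 'rV[R]_d.
Local Notation mu := (lebesgue_rV d).
Local Notation leb := (@lebesgue_measure R).
Variables (O : set Rd) (i : 'I_d) (U G : Rd -> R).
Local Notation e := (delta_mx 0 i : Rd).
Hypothesis iU : mu.-integrable setT (EFin \o U).
Hypothesis iG : mu.-integrable setT (EFin \o G).
Hypothesis weakUG : forall phi, test_function O phi ->
  \int[mu]_x (partial i phi x * U x) = - \int[mu]_x (phi x * G x).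

(** The defect [f] integrates to 0 against the bumps of every sub-box, whose shifts stay in [O].
    Dominated convergence, with [|f|] dominating, replaces the bumps by indicators, and
    [ae_eq0_boxes] concludes. *)
Lemma difference_box (a b : Rd) (h : R) : 0 < h ->
  (forall s, 0 <= s <= h -> cbox (a - s *: e) (b - s *: e) `<=` O) ->
  {ae mu, forall x, box a b x -> U x - U (x - h *: e) = line_average i G h x}.
Proof.
move=> h0 abO.
pose f x := U x - U (x - h *: e) - line_average i G h x.
have iD : mu.-integrable setT (EFin \o line_average i G h).
  exact: integrable_line_average (ltW h0).
have iUh : mu.-integrable setT (EFin \o (fun x => U (x - h *: e))).
  exact: (integrable_translate (- (h *: e)) iU).
have iDU : mu.-integrable setT (EFin \o (fun x => U x - U (x - h *: e))).
  exact: (integrableB measurableT iU iUh).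
have intf : mu.-integrable setT (EFin \o f) := integrableB measurableT iDU iD.
suff : {ae mu, forall x, box a b x -> f x = 0}.
  by apply: filterS => x h' /h'; rewrite /f => /eqP; rewrite subr_eq0 => /eqP.
apply: ae_eq0_boxes => // a' b'.
have [a2 [b2 [E ab2]]] : exists a2 b2, box a' b' `&` box a b = box a2 b2 /\
    forall s, cbox (a2 - s *: e) (b2 - s *: e) `<=` cbox (a - s *: e) (b - s *: e).
  exists (\row_j Num.max (a' 0 j) (a 0 j)), (\row_j Num.min (b' 0 j) (b 0 j)).
  split.
    apply/seteqP; split => [x [h1 h2] j|x h1]; rewrite ?mxE.
      rewrite gt_max lt_min; have /andP[? ?] := h1 j; have /andP[? ?] := h2 j.
      by apply/andP; split; apply/andP.
    split => j; have := h1 j; rewrite !mxE gt_max lt_min.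
      by move=> /andP[/andP[? _] /andP[? _]]; apply/andP.
    by move=> /andP[/andP[_ ?] /andP[_ ?]]; apply/andP.
  move=> s x h1 j; have := h1 j; rewrite !mxE !lerBlDr !lerBrDr ge_max le_min.
  by move=> /andP[/andP[_ ->] /andP[_ ->]].
rewrite E.
have bumpf n : (\int[mu]_x (box_bump n a2 b2 x * f x)%:E = 0)%E.
  have mb : measurable_fun setT (box_bump n a2 b2).
    exact: continuous_measurable_rV (is_Ck_cont (box_bump_smooth n a2 b2 0%N)).
  have b1 x : `|box_bump n a2 b2 x| <= 1.
    by rewrite ger0_norm ?box_bump_ge0// box_bump_le1.
  have ibf := integrable_bndM mb b1 intf.
  rewrite -[LHS]fineK; last exact: (integrable_fin_num measurableT ibf).
  congr EFin.
  have : \int[mu]_x (box_bump n a2 b2 x * (U x - U (x - h *: e))) =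
      \int[mu]_x (box_bump n a2 b2 x * line_average i G h x).
    apply: (weak_difference iU iG weakUG h0) => s sh.
    rewrite (_ : (fun _ => _) = box_bump n (a2 - s *: e) (b2 - s *: e)).
      by apply: box_bump_test; apply: subset_trans (ab2 s) (abO s sh).
    by apply/funext => x; rewrite box_bump_translate.
  move=> /eqP; rewrite -subr_eq0 -RintegralB//.
  - by move=> /eqP <-; apply: eq_Rintegral => x _; rewrite /f mulrBr.
  - exact: (integrable_bndM mb b1 iDU).
  - exact: (integrable_bndM mb b1 iD).
have iaf : mu.-integrable setT (abse \o (EFin \o f)).
  exact: integrable_abse.
have mf := integrable_measurable intf.
have mbn n : measurable_fun setT (fun x => (box_bump n a2 b2 x * f x)%:E).
  apply/measurable_EFinP; apply: measurable_funM => //.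
  exact: continuous_measurable_rV (is_Ck_cont (box_bump_smooth n a2 b2 0%N)).
have mbox : measurable_fun setT (fun x => (\1_(box a2 b2) x * f x)%:E).
  by apply/measurable_EFinP; apply: measurable_funM => //;
    exact: measurable_indic (measurable_box a2 b2).
have [||_ _] := dominated_convergence measurableT mbn mbox _ iaf _.
- apply: aeW => x _; apply: cvg_EFin; first exact: nearW.
  by apply: (@cvgM _ _ _ _ (fun n => box_bump n a2 b2 x) (fun=> f x));
    [exact: box_bump_cvg|exact: cvg_cst].
- apply: aeW => x n _ /=; rewrite lee_fin normrM ler_piMl//.
  by rewrite ger0_norm ?box_bump_ge0// box_bump_le1.
move=> cv.
have <- : (\int[mu]_x (\1_(box a2 b2) x * f x)%:E = \int[mu]_(x in box a2 b2) (f x)%:E)%E.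
  rewrite [RHS]integral_mkcond; apply: eq_integral => x _.
  by rewrite patchE indicE; case: ifP => _; rewrite ?mul1r ?mul0r.
apply: cvg_unique cv _ => //.
rewrite (_ : (fun _ => _) = cst 0%E); first exact: cvg_cst.
by apply/funext => n; exact: bumpf.
Qed.

Lemma difference_compact (K : set Rd) : open O -> compact K -> K `<=` O ->
  exists2 r, 0 < r & forall h, 0 < h < r ->
  {ae mu, forall x, K x -> U x - U (x - h *: e) = line_average i G h x}.
Proof.
move=> oO cK KO.
(* One [r] serves all of [K]: a closed box of half-width [r] about a point of [K], shifted by at
   most [h < r], stays within [3 * r] of that point. *)
have [r r0 rO] : exists2 r : R, 0 < r & forall x, K x -> ball x (3 * r) `<=` O.
  have /compact_near_coveringP ncK := cK.
  have H : \forall r \near (0:R)^'+, K `<=` (fun x => ball x (3 * r) `<=` O).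
    apply: (ncK R (0 : R)^'+ (fun r x => ball x (3 * r) `<=` O)) => x Kx.
    have /nbhs_ballP[d0 /= d00 xO] : nbhs x O by apply: open_nbhs_nbhs; split => //;
      exact: KO.
    exists (ball x (d0 / 2), [set r | r < d0 / 6]).
      split; first by apply: nbhsx_ballx; rewrite divr_gt0.
      by apply: nbhs_right_lt; rewrite divr_gt0.
    move=> [x' r] [/= xx' rd] y x'y; apply: xO.
    apply: (@le_ball _ _ _ (d0 / 2 + 3 * r)); first by lra.
    exact: ball_triangle x'y.
  have H0 : \forall r \near (0:R)^'+, 0 < r by exact: nbhs_right_gt.
  have : \forall r \near (0:R)^'+, 0 < r /\ K `<=` (fun x => ball x (3 * r) `<=` O).
    by apply: filter_app H; apply: filterS H0.
  by move=> /filter_ex[r [r0 rO]]; exists r.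
exists r => // h /andP[h0 hr].
(* Finitely many balls cover [K], so finitely many null sets are discarded. These depend on [h]; the
   radius [r] does not. *)
have : cover_compact K by rewrite -compact_cover.
move=> /(_ _ K (fun x => ball x r)) [x _| x Kx|D DK KD].
- exact: ball_open.
- by exists x => //; exact: ballxx.
have : \forall x \near almost_everywhere mu, (\bigcap_(q in [set` D])
    [set x : Rd | ball q r x -> U x - U (x - h *: e) = line_average i G h x]) x.
  apply: filter_bigI => q qD; have Kq : K q by exact/set_mem/DK.
  have bE : ball q r = box (q - const_mx r) (q + const_mx r) :> set Rd.
    apply/seteqP; split => x.
      by move=> [_ bx] j; have := bx 0 j; rewrite ball_itv /= in_itv /= !mxE.
    move=> bx; split => // k j; rewrite ord1; have := bx j.
    by rewrite ball_itv /= in_itv /= !mxE.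
  have := @difference_box (q - const_mx r) (q + const_mx r) h h0.
  rewrite -bE; apply => s /andP[s0 sh].
  apply: subset_trans (rO q Kq) => y qy; split; first by rewrite mulr_gt0.
  move=> k j; rewrite ord1 ball_itv /= in_itv /=; have := qy j; rewrite !mxE eqxx /=.
  by case: (j == i); rewrite ?mulr1 ?mulr0 => /andP[h1 h2]; apply/andP; split; lra.
apply: filterS => x hx Kx; have [q qD qx] := KD x Kx.
exact: (hx q qD).
Qed.

End difference_quotient_ae.

Section ae_bounds.
Context d (T : measurableType d) (R : realType).
Variable mu : {measure set T -> \bar R}.
Implicit Types f g : T -> R.

Lemma ae_le_integrable f g : measurable_fun setT f ->
  mu.-integrable setT (EFin \o g) -> {ae mu, forall x, `|f x| <= g x} ->
  mu.-integrable setT (EFin \o f).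
Proof.
move=> mf ig fg; have mg := integrable_measurable ig.
apply/integrableP; split; first exact/measurable_EFinP.
have /integrableP[_] := ig; apply: le_lt_trans.
apply: ae_ge0_le_integral => //.
- by apply: measurableT_comp => //; exact/measurable_EFinP.
- by apply: measurableT_comp => //; exact/measurable_EFinP.
- by apply: filterS fg => x fg _; rewrite /= lee_fin (le_trans fg)// ler_norm.
Qed.

Lemma ae_le_Rintegral f g : mu.-integrable setT (EFin \o f) ->
  mu.-integrable setT (EFin \o g) -> {ae mu, forall x, f x <= g x} ->
  \int[mu]_x f x <= \int[mu]_x g x.
Proof.
move=> jf ig fg; have mf := integrable_measurable jf;
  have mg := integrable_measurable ig.
rewrite -subr_ge0 -RintegralB//.
rewrite (@ae_eq_Rintegral _ _ _ mu _ (fun x => `|g x - f x|)).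
- exact: Rintegral_ge0.
- exact: measurable_funB.
- by apply: measurableT_comp => //; exact: measurable_funB.
- by apply: filterS fg => x fg; rewrite ger0_norm// subr_ge0.
Qed.

Lemma ae_normr_Rintegral f g : measurable_fun setT f ->
  mu.-integrable setT (EFin \o g) -> {ae mu, forall x, `|f x| <= g x} ->
  `|\int[mu]_x f x| <= \int[mu]_x g x.
Proof.
move=> mf ig fg; have jf := ae_le_integrable mf ig fg.
apply: le_trans (le_normr_Rintegral measurableT jf) _.
by apply: ae_le_Rintegral => //; exact: (integrable_abse jf).
Qed.

End ae_bounds.

(** * The L^2 bound on increments *)

Section line_average_sqr.
Context {R : realType} {d : nat}.
Local Notation Rd := 'rV[R]_d.
Local Notation mu := (lebesgue_rV d).
Local Notation leb := (@lebesgue_measure R).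
Variables (i : 'I_d) (G : Rd -> R).
Local Notation e := (delta_mx 0 i : Rd).
Hypothesis iG : mu.-integrable setT (EFin \o G).
Hypothesis iG2 : mu.-integrable setT (EFin \o (fun x => G x ^+ 2)).

Lemma Rintegral_indic_itv (h : R) : 0 < h -> \int[leb]_s \1_`[0, h] s = h.
Proof.
move=> h0; rewrite /Rintegral integral_indic// setIT /= lebesgue_measure_itv /= lte_fin h0.
by rewrite -EFinB subr0.
Qed.

(** Cauchy-Schwarz against the constant 1, obtained from the nonnegativity of the integral of (F -
    m)^2 over [0, h], with m the mean of F there. *)
Lemma sqr_Rintegral_itv (F : R -> R) (h : R) : 0 < h -> measurable_fun setT F ->
  leb.-integrable setT (EFin \o (fun s => \1_`[0, h] s * F s ^+ 2)) ->
  (\int[leb]_s (\1_`[0, h] s * F s)) ^+ 2 <= h * \int[leb]_s (\1_`[0, h] s * F s ^+ 2).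
Proof.
move=> h0 mF iF2.
have i1 : leb.-integrable setT (EFin \o (\1_`[0, h] : R -> R)).
  exact: (integrable_indic_itv 0 h true false).
have m1 := integrable_measurable i1.
have iF : leb.-integrable setT (EFin \o (fun s => \1_`[0, h] s * F s)).
  apply: (@integrable_le _ _ _ leb (fun s => \1_`[0, h] s * F s)
    (fun s => \1_`[0, h] s + \1_`[0, h] s * F s ^+ 2)).
  - exact: measurable_funM.
  - move=> s; rewrite indicE; case: (_ \in _); rewrite ?mul0r ?normr0 ?addr0// !mul1r.
    rewrite -(real_normK (num_real (F s))).
    rewrite mulr1n; by have := sqr_ge0 (`|F s| - 1); have := normr_ge0 (F s); nra.
  - exact: (integrableD measurableT i1 iF2).
set D := \int[leb]_s _; set J := \int[leb]_s _.
pose m := D / h.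
have : 0 <= \int[leb]_s (\1_`[0, h] s * (F s - m) ^+ 2).
  by apply: Rintegral_ge0 => s _; rewrite mulr_ge0 ?sqr_ge0// indicE.
have -> : \int[leb]_s (\1_`[0, h] s * (F s - m) ^+ 2) = J - 2 * m * D + m ^+ 2 * h.
  rewrite -[X in _ = _ + _ * X](Rintegral_indic_itv h0) -!RintegralZl// -RintegralB//;
    last first.
    exact: (integrableZl measurableT (2 * m) iF).
  rewrite -RintegralD//.
  - by apply: eq_Rintegral => s _; ring.
  - exact: (integrableB measurableT iF2 (integrableZl measurableT (2 * m) iF)).
  - exact: (integrableZl measurableT (m ^+ 2) i1).
have -> : m ^+ 2 * h = m * D by rewrite expr2 -mulrA /m divfK// gt_eqF.
rewrite (_ : J - _ + _ = (h * J - D ^+ 2) / h); last first.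
  by rewrite /m; field; rewrite gt_eqF.
by rewrite pmulr_lge0 ?invr_gt0// subr_ge0.
Qed.

(** Cauchy-Schwarz on each segment costs one factor [h]; integrating in [x], Fubini's theorem and
    translation invariance give the other. *)
Lemma line_average_sqr (h : R) : 0 < h ->
  mu.-integrable setT (EFin \o (fun x => line_average i G h x ^+ 2)) /\
  \int[mu]_x (line_average i G h x ^+ 2) <= h ^+ 2 * \int[mu]_x (G x ^+ 2).
Proof.
move=> h0; have h0' := ltW h0.
have mG := integrable_measurable iG.
have iD := integrable_line_average i iG h0'.
have c1 (p : measurableTypeR R * Rd) : `|(1 : R)| <= 1 by rewrite normr1.
have intf := @integrable_shear _ _ (- e) h 1 (fun=> 1) _ h0' (measurable_cst _) c1 iG2.
pose J x := \int[leb]_s (\1_`[0, h] s * (1 * G (x + s *: - e) ^+ 2)).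
have iJ : mu.-integrable setT (EFin \o J) by exact: integrable_fubini2 intf.
have iD2J : {ae mu, forall x, line_average i G h x ^+ 2 <= h * J x}.
  have := ae_integrable2 intf; apply: filterS => x /= ix.
  have mF : measurable_fun setT (fun s : R => G (x - s *: e)).
    have := measurable_fun_pair1 x (measurableT_comp mG (measurable_shear (- e))).
    by apply: eq_measurable_fun => s _; rewrite /= scalerN.
  have := sqr_Rintegral_itv h0 mF.
  rewrite /J (_ : (fun s => _ * (1 * _)) = (fun s => \1_`[0, h] s * G (x - s *: e) ^+ 2)).
    apply; apply: eq_integrable ix => // s _.
    by rewrite /= mul1r scalerN.
  by apply/funext => s; rewrite mul1r scalerN.
have iJh : mu.-integrable setT (EFin \o (fun x => h * J x)).
  exact: (integrableZl measurableT h iJ).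
have iD2 : mu.-integrable setT (EFin \o (fun x => line_average i G h x ^+ 2)).
  apply: ae_le_integrable iJh _.
    by apply: measurable_funX; exact: integrable_measurable iD.
  by apply: filterS iD2J => x; rewrite ger0_norm// sqr_ge0.
split => //; apply: le_trans (ae_le_Rintegral iD2 iJh iD2J) _.
rewrite RintegralZl// expr2 -mulrA ler_wpM2l//.
rewrite /J -(Rintegral_fubini intf) /=.
rewrite -[X in _ <= X * _](Rintegral_indic_itv h0) -RintegralZr//; last first.
  exact: (integrable_indic_itv 0 h true false).
rewrite le_eqVlt; apply/orP; left; apply/eqP; apply: eq_Rintegral => s _.
have iG2s := integrable_translate (- (s *: e)) iG2.
rewrite RintegralZl//; last first.
  by apply: eq_integrable iG2s => // x _; rewrite /= mul1r scalerN.
congr (_ * _); rewrite -(Rintegral_translate (- (s *: e)) (f := fun x => G x ^+ 2)).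
  by apply: eq_Rintegral => x _; rewrite /= mul1r scalerN.
exact: measurable_funX.
Qed.

End line_average_sqr.

(** * The weak chain rule *)

Lemma eq0_of_small (R : realFieldType) (y r C : R) : 0 < r ->
  (forall h, 0 < h < r -> `|y| <= C * h) -> y = 0.
Proof.
move=> r0 H; apply: contrapT => /eqP; rewrite -normr_gt0 => y0.
have C0 : 0 <= `|C| by [].
have d0 : 0 < `|y| / (2 * (`|C| + 1)) by rewrite divr_gt0 ?mulr_gt0// ltr_wpDl.
pose h := Num.min (r / 2) (`|y| / (2 * (`|C| + 1))).
have h0 : 0 < h by rewrite lt_min d0 divr_gt0.
have hr : h < r by rewrite gt_min; apply/orP; left; lra.
have := H h; rewrite h0 hr => /(_ isT).
have hy : h <= `|y| / (2 * (`|C| + 1)) by rewrite ge_min lexx orbT.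
have : C * h <= `|C| * h by rewrite ler_wpM2r ?ler_norm// ltW.
have : h * (2 * (`|C| + 1)) <= `|y| by rewrite -ler_pdivlMr// mulr_gt0// ltr_wpDl.
have := mulr_ge0 C0 (ltW h0).
by nra.
Qed.

Section chain_rule.
Context {R : realType} {d : nat}.
Local Notation Rd := 'rV[R]_d.
Local Notation mu := (lebesgue_rV d).
Local Notation leb := (@lebesgue_measure R).
Variables (O : set Rd) (i : 'I_d) (U G : Rd -> R).
Local Notation e := (delta_mx 0 i : Rd).
Hypothesis oO : open O.
Hypothesis iU : mu.-integrable setT (EFin \o U).
Hypothesis iG : mu.-integrable setT (EFin \o G).
Hypothesis iG2 : mu.-integrable setT (EFin \o (fun x => G x ^+ 2)).
Hypothesis weakUG : forall phi, test_function O phi ->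
  \int[mu]_x (partial i phi x * U x) = - \int[mu]_x (phi x * G x).
Variables (F F' : R -> R) (M L : R).
Hypothesis mF : measurable_fun setT F.
Hypothesis mF' : measurable_fun setT F'.
Hypothesis F_lip : forall a b, `|F b - F a| <= M * `|b - a|.
Hypothesis F'_le : forall a, `|F' a| <= M.
Hypothesis F'_lip : forall a b, `|F' b - F' a| <= L * `|b - a|.
Hypothesis F_taylor : forall a b, `|F b - F a - F' a * (b - a)| <= L * (b - a) ^+ 2.

Let mU := integrable_measurable iU.
Let mG := integrable_measurable iG.
Let mV : measurable_fun setT (F \o U) := measurableT_comp mF mU.
Let mW : measurable_fun setT (F' \o U) := measurableT_comp mF' mU.
Let N1 := \int[mu]_x `|G x|.
Let N2 := \int[mu]_x (G x ^+ 2).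

Let M_ge0 : 0 <= M. Proof. exact: le_trans (F'_le 0). Qed.

Let L_ge0 : 0 <= L.
Proof. by have := F'_lip 0 1; rewrite subr0 normr1 mulr1; exact: le_trans. Qed.

Let mtr (f : Rd -> R) v : measurable_fun setT f ->
  measurable_fun setT (fun x : Rd => f (x + v)).
Proof. by move=> mf; apply: (measurableT_comp mf); exact: measurable_translate. Qed.

Section test.
Variables (phi : Rd -> R) (K : set Rd) (M0 M1 : R).
Hypothesis mphi : measurable_fun setT phi.
Hypothesis phi0 : forall x, ~ K x -> phi x = 0.
Hypothesis phi_le : forall x, `|phi x| <= M0.
Hypothesis phi_lip : forall x s, 0 <= s -> `|phi (x + s *: e) - phi x| <= M1 * s.

Let M0_ge0 : 0 <= M0. Proof. exact: le_trans (phi_le 0). Qed.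
Let M1_ge0 : 0 <= M1.
Proof. by have := phi_lip 0 ler01; rewrite mulr1; exact: le_trans. Qed.

Let Psi x := phi x * F' (U x).
Let mPsi : measurable_fun setT Psi. Proof. exact: measurable_funM. Qed.
Let Psi_le x : `|Psi x| <= M0 * M.
Proof. by rewrite normrM ler_pM. Qed.

(** On [K] the integrand is [phi] times the remainder in [F_taylor], quadratic in the increment of
    [U], which is [line_average] there. Off [K] both terms vanish with [phi]. *)
Lemma chain_difference (h : R) : 0 < h ->
  {ae mu, forall x, K x -> U x - U (x - h *: e) = line_average i G h x} ->
  `|\int[mu]_x (phi x * (F (U (x - h *: e)) - F (U x))) +
    \int[mu]_x (Psi x * line_average i G h x)| <= M0 * L * N2 * h ^+ 2.
Proof.
move=> h0 UD; have [iD2 D2le] := line_average_sqr i iG iG2 h0.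
have iD := integrable_line_average i iG (ltW h0).
have iUh : mu.-integrable setT (EFin \o (fun x => U (x - h *: e))).
  exact: (integrable_translate (- (h *: e)) iU).
have mD := integrable_measurable iD.
have mVh : measurable_fun setT (fun x : Rd => F (U (x - h *: e))).
  exact: (mtr (- (h *: e)) mV).
have i1 : mu.-integrable setT (EFin \o (fun x => phi x * (F (U (x - h *: e)) - F (U x)))).
  apply: (integrable_bndM mphi phi_le).
  apply: (@integrable_le _ _ _ mu _ (fun x => M * `|U (x - h *: e) - U x|)) => //.
    exact: measurable_funB.
  exact: (integrableZl measurableT M (integrable_abse (integrableB measurableT iUh iU))).
have i2 := integrable_bndM mPsi Psi_le iD.
rewrite -RintegralD//.
have iB : mu.-integrable setT (EFin \o (fun x => M0 * L * line_average i G h x ^+ 2)).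
  exact: (integrableZl measurableT (M0 * L) iD2).
apply: le_trans (ae_normr_Rintegral _ iB _) _.
- exact: (measurable_funD (integrable_measurable i1) (integrable_measurable i2)).
- apply: filterS UD => x xD.
  have [Kx|nKx] := pselect (K x); last first.
    by rewrite /Psi phi0// !mul0r addr0 normr0; apply: mulr_ge0;
      [exact: mulr_ge0|exact: sqr_ge0].
  rewrite -(xD Kx) /Psi -mulrA -mulrDr normrM -mulrA ler_pM//.
  have := F_taylor (U x) (U (x - h *: e)).
  by rewrite -mulrN opprB -sqrrN opprB.
- rewrite RintegralZl// -[leRHS]mulrA ler_wpM2l ?mulr_ge0// mulrC; exact: D2le.
Qed.

(** The error splits according to which factor of [phi * F' (U)] is incremented: the Lipschitz bound
    on [F'] yields [M0 * L * N2], that on [phi] yields [M * M1 * N1]. *)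
Lemma chain_continuity (s : R) : 0 < s ->
  {ae mu, forall x, K x -> U x - U (x - s *: e) = line_average i G s x} ->
  `|\int[mu]_x (Psi x * G (x - s *: e)) - \int[mu]_x (Psi x * G x)| <=
    (M0 * L * N2 + M * M1 * N1) * s.
Proof.
move=> s0 UD; have [iD2 D2le] := line_average_sqr i iG iG2 s0.
have iGs : mu.-integrable setT (EFin \o (fun x => G (x - s *: e))).
  exact: (integrable_translate (- (s *: e)) iG).
have mGs := integrable_measurable iGs.
have iG2s : mu.-integrable setT (EFin \o (fun x => G (x - s *: e) ^+ 2)).
  exact: (integrable_translate (- (s *: e)) iG2).
have iaGs : mu.-integrable setT (EFin \o (fun x => `|G (x - s *: e)|)).
  exact: (integrable_abse iGs).
have mPsis : measurable_fun setT (fun x : Rd => Psi (x - s *: e)).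
  exact: (mtr (- (s *: e)) mPsi).
(* Translating this integral makes both carry the same shifted factor, so that the increment falls
   on [Psi] and not on the merely integrable [G]. *)
have -> : \int[mu]_x (Psi x * G x) = \int[mu]_x (Psi (x - s *: e) * G (x - s *: e)).
  rewrite -(Rintegral_translate (- (s *: e)) (f := fun x => Psi x * G x))//.
  exact: measurable_funM.
have i1 := integrable_bndM mPsi Psi_le iGs.
have i2 := integrable_bndM mPsis (fun x => Psi_le _) iGs.
rewrite -RintegralB//.
(* Young's inequality with weight [s]: the increment of [U] is O(s) in L^2, so [s^-1] times its
   square and [s] times the square of [G] both integrate to O(s). *)
pose g x := M0 * L / 2 * (s^-1 * line_average i G s x ^+ 2 + s * G (x - s *: e) ^+ 2)
  + M * M1 * s * `|G (x - s *: e)|.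
have ig1 : mu.-integrable setT (EFin \o (fun x =>
    s^-1 * line_average i G s x ^+ 2 + s * G (x - s *: e) ^+ 2)).
  exact: (integrableD measurableT (integrableZl measurableT s^-1 iD2)
                                  (integrableZl measurableT s iG2s)).
have ig2 : mu.-integrable setT (EFin \o (fun x => M0 * L / 2 *
    (s^-1 * line_average i G s x ^+ 2 + s * G (x - s *: e) ^+ 2))).
  exact: (integrableZl measurableT (M0 * L / 2) ig1).
have ig3 : mu.-integrable setT (EFin \o (fun x => M * M1 * s * `|G (x - s *: e)|)).
  exact: (integrableZl measurableT (M * M1 * s) iaGs).
have ig : mu.-integrable setT (EFin \o g) := integrableD measurableT ig2 ig3.
apply: le_trans (ae_normr_Rintegral _ ig _) _.
- exact: (measurable_funB (integrable_measurable i1) (integrable_measurable i2)).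
- apply: filterS UD => x xD.
  rewrite -mulrBl (_ : Psi x - _ = phi x * (F' (U x) - F' (U (x - s *: e))) +
    F' (U (x - s *: e)) * (phi x - phi (x - s *: e))); last by rewrite /Psi; ring.
  rewrite mulrDl (le_trans (ler_normD _ _))// /g lerD//.
    have [Kx|nKx] := pselect (K x); last first.
      rewrite phi0// !mul0r normr0 mulr_ge0 ?mulr_ge0// addr_ge0// mulr_ge0 ?sqr_ge0 ?invr_ge0 ?ltW//.
    rewrite !normrM -(xD Kx).
    have le1 : `|F' (U x) - F' (U (x - s *: e))| <= L * `|U x - U (x - s *: e)|.
      exact: F'_lip.
    apply: (@le_trans _ _ (M0 * (L * `|U x - U (x - s *: e)|) * `|G (x - s *: e)|)).
      by rewrite ler_wpM2r// ler_pM.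
    rewrite -(real_normK (num_real (U x - _))) -(real_normK (num_real (G _))).
    set p := `|_ - _|; set q := `|G _|.
    rewrite (_ : _ * q = M0 * L * (p * q)); last by ring.
    rewrite -[leRHS]mulrA ler_wpM2l ?mulr_ge0//.
    rewrite -subr_ge0 (_ : _ - _ = s^-1 / 2 * (p - s * q) ^+ 2); last first.
      by field; rewrite gt_eqF.
    by rewrite mulr_ge0 ?sqr_ge0// divr_ge0// invr_ge0 ltW.
  rewrite !normrM ler_wpM2r// -mulrA ler_pM//.
  by have := phi_lip (x - s *: e) (ltW s0); rewrite subrK.
- rewrite /g RintegralD// RintegralZl// RintegralD//; last 2 first.
  + exact: (integrableZl measurableT s^-1 iD2).
  + exact: (integrableZl measurableT s iG2s).
  rewrite !RintegralZl//.
  have -> : \int[mu]_x (G (x - s *: e) ^+ 2) = N2.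
    apply: (Rintegral_translate (- (s *: e)) (f := fun x => G x ^+ 2)).
    exact: measurable_funX.
  have -> : \int[mu]_x `|G (x - s *: e)| = N1.
    apply: (Rintegral_translate (- (s *: e)) (f := fun x => `|G x|)).
    exact: measurableT_comp.
  rewrite mulrDl lerD//; last by rewrite mulrAC.
  rewrite -!mulrA ler_wpM2l// ler_wpM2l//.
  have : s^-1 * \int[mu]_x (line_average i G s x ^+ 2) <= s * N2.
    rewrite ler_pdivrMl// mulrA -expr2; exact: D2le.
  rewrite [N2 * s]mulrC; lra.
Qed.

End test.
(** This is [chain_continuity] integrated over [s] in [0, h], its bound linear in [s] being replaced
    by the value at [h]; the endpoint [s = 0] is trivial and treated apart. *)
Lemma chain_average (phi : Rd -> R) (K : set Rd) (M0 M1 h : R) :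
  measurable_fun setT phi -> (forall x, ~ K x -> phi x = 0) ->
  (forall x, `|phi x| <= M0) ->
  (forall x s, 0 <= s -> `|phi (x + s *: e) - phi x| <= M1 * s) ->
  0 < h ->
  (forall s, 0 < s <= h ->
    {ae mu, forall x, K x -> U x - U (x - s *: e) = line_average i G s x}) ->
  `|\int[mu]_x (phi x * F' (U x) * line_average i G h x) -
    h * \int[mu]_x (phi x * F' (U x) * G x)| <= (M0 * L * N2 + M * M1 * N1) * h ^+ 2.
Proof.
move=> mphi phi0 phi_le phi_lip h0 UD; have h0' := ltW h0.
set C := M0 * L * N2 + _.
have M0_ge0 : 0 <= M0 by exact: le_trans (phi_le 0).
have M1_ge0 : 0 <= M1 by have := phi_lip 0 1 ler01; rewrite mulr1; exact: le_trans.
have C0 : 0 <= C by rewrite addr_ge0// !mulr_ge0// Rintegral_ge0// => x _;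
  exact: sqr_ge0.
pose Psi x := phi x * F' (U x).
have mPsi : measurable_fun setT Psi by exact: measurable_funM.
have Psi_le x : `|Psi x| <= M0 * M by rewrite normrM ler_pM.
rewrite (line_averageM i iG h0' mPsi Psi_le).
have i1 : leb.-integrable setT (EFin \o (\1_`[0, h] : R -> R)).
  exact: (integrable_indic_itv 0 h true false).
have mPsi2 : measurable_fun setT (fun p : measurableTypeR R * Rd => Psi p.2).
  exact: measurableT_comp.
have intf := integrable_shear (- e) h0' mPsi2 (fun p => Psi_le p.2) iG.
have iX : leb.-integrable setT
    (EFin \o (fun s => \1_`[0, h] s * \int[mu]_x (Psi x * G (x - s *: e)))).
  have := integrable_fubini1 intf; apply: eq_integrable => // s _ /=.
  congr EFin; have iGs := integrable_translate (- (s *: e)) iG.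
  rewrite -RintegralZl//; last exact: (integrable_bndM mPsi Psi_le iGs).
  by apply: eq_Rintegral => x _; rewrite /= scalerN.
rewrite -[X in _ - X * _](Rintegral_indic_itv h0) -RintegralZr// -RintegralB//;
  last first.
  exact: (integrableZr measurableT _ i1).
have iC : leb.-integrable setT (EFin \o (fun s => C * h * \1_`[0, h] s)).
  exact: (integrableZl measurableT (C * h) i1).
apply: le_trans (ae_normr_Rintegral _ iC _) _.
- apply: (measurable_funB (integrable_measurable iX)).
  exact: (integrable_measurable (integrableZr measurableT _ i1)).
- apply: aeW => s /=; rewrite indicE; case: (boolP (s \in _)); last first.
    by rewrite !mul0r subr0 normr0 mulr0.
  move=> /set_mem /=; rewrite in_itv /= => /andP[s0 sh]; rewrite !mul1r mulr1.
  move: s0; rewrite le_eqVlt => /predU1P[<-|s0].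
    under eq_Rintegral do rewrite scale0r subr0.
    by rewrite subrr normr0 mulr_ge0.
  have UDs := UD s; rewrite s0 sh in UDs.
  apply: le_trans (chain_continuity mphi phi0 phi_le phi_lip s0 (UDs isT)) _.
  by rewrite ler_wpM2l.
- by rewrite RintegralZl// Rintegral_indic_itv// -mulrA -expr2.
Qed.

(* Summation by parts turns [partial i phi * F (U x)] into the difference
   [F (U x) - F (U (x - h e))], which [F_taylor] linearizes; after multiplication
   by [h] every error is O(h^2) because differences of [U] are O(h) in L^2. *)
Lemma weak_chain_rule (phi : Rd -> R) : test_function O phi ->
  \int[mu]_x (partial i phi x * F (U x)) = - \int[mu]_x (phi x * (F' (U x) * G x)).
Proof.
move=> [sphi [K [cK KO phi0]]].
have cphi := is_Ck_cont (sphi 0%N).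
have [_ /(_ i)[dphi [cdphi /(_ i)[ddphi cddphi]]]] := sphi 2%N.
have dphi0 := partial_support i cK phi0.
have [M0 M00 hM0] := compact_support_bounded cphi cK phi0.
have [M1 M10 hM1] := compact_support_bounded cdphi cK dphi0.
have [M2 M20 hM2] := compact_support_bounded cddphi cK (partial_support i cK dphi0).
have mphi := continuous_measurable_rV cphi.
have mdphi := continuous_measurable_rV cdphi.
have [r r0 UD] := difference_compact iU iG weakUG oO cK KO.
have [N N0 KN] : exists2 N : R, 0 <= N & forall x, K x -> `|x| <= N.
  have [N [_ KN]] := compact_bounded cK.
  exists (`|N| + 1) => [|x Kx]; first by rewrite addr_ge0.
  by apply: (KN (`|N| + 1)) => //; rewrite ltr_pwDr// ler_norm.
(* [F (U x)] equals [F 0] wherever [U] vanishes and need not be integrable over the whole space, so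
   it is cut off to [V]. The box contains [K] and its shifts by less than 1, the only places where
   the test functions see it. *)
pose B := box (const_mx (- (N + 2))) (const_mx (N + 2) : Rd).
have BN x h : 0 <= h < 1 -> K (x + h *: e) -> B x.
  move=> /andP[h0 h1] /KN xN j; rewrite !mxE -ltr_norml.
  have : `|(x + h *: e) 0 j| <= N.
    apply: le_trans xN; rewrite [leRHS]/Num.norm /= mx_normrE.
    by apply/bigmax_geP; right => /=; exists (0, j).
  rewrite !mxE eqxx /= !ler_norml ltr_norml.
  by case: (j == i); rewrite ?mulr1 ?mulr0 => /andP[? ?]; apply/andP; split; lra.
have mB : measurable B := measurable_box _ _.
pose V x := \1_B x * F (U x).
have iB : mu.-integrable setT (EFin \o (\1_B : Rd -> R)).
  apply/integrableP; split; first by apply/measurable_EFinP; exact: measurable_indic.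
  rewrite (_ : (fun _ => _) = (fun x => (\1_B x)%:E)).
    by rewrite integral_indic// setIT; exact: lebesgue_rV_box_lty.
  by apply/funext => x; rewrite /= ger0_norm// indicE.
have mV' : measurable_fun setT V.
  by apply: measurable_funM => //; exact: measurable_indic.
have iV : mu.-integrable setT (EFin \o V).
  apply: (@integrable_le _ _ _ mu _ (fun x => `|F 0| * \1_B x + M * `|U x|)) => //.
    move=> x; rewrite /V indicE; case: (_ \in _); last first.
      by rewrite mul0r normr0 mulr0 add0r mulr_ge0.
    rewrite mul1r mulr1 -[F (U x)](subrK (F 0)) (le_trans (ler_normD _ _))//.
    by rewrite addrC lerD2l; have := F_lip 0 (U x); rewrite subr0.
  exact: (integrableD measurableT (integrableZl measurableT _ iB)
                                  (integrableZl measurableT M (integrable_abse iU))).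
have VE (f : Rd -> R) h x : 0 <= h < 1 -> (~ K (x + h *: e) -> f x = 0) ->
    f x * F (U x) = f x * V x.
  move=> h01 f0; have [Kx|nKx] := pselect (K (x + h *: e)).
    by rewrite /V indicE mem_set ?mul1r//; exact: BN Kx.
  by rewrite f0// !mul0r.
have h00 : 0 <= (0 : R) < 1 by rewrite lexx ltr01.
apply/eqP; rewrite -subr_eq0 opprK; apply/eqP.
apply: (@eq0_of_small _ _ (Num.min r 1)
  (M2 * \int[mu]_x `|V x| + M0 * L * N2 + (M0 * L * N2 + M * M1 * N1))).
  by rewrite lt_min r0 ltr01.
move=> h; rewrite lt_min => /and3P[h0 hr h1].
have h01 : 0 <= h < 1 by rewrite ltW.
rewrite -(ler_pM2l h0) -{1}(ger0_norm (ltW h0)) -normrM.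
have Ks s : 0 < s <= h ->
    {ae mu, forall x, K x -> U x - U (x - s *: e) = line_average i G s x}.
  by move=> /andP[s0 sh]; apply: UD; rewrite s0 (le_lt_trans sh).
have lip := lipschitz_line dphi hM1.
have mphih : measurable_fun setT (fun x : Rd => phi (x + h *: e)) := mtr (h *: e) mphi.
have EC := chain_average mphi phi0 hM0 lip h0 Ks.
have hh : 0 < h <= h by rewrite h0 lexx.
have EB := chain_difference mphi phi0 hM0 h0 (Ks h hh).
have -> : \int[mu]_x (partial i phi x * F (U x)) = \int[mu]_x (partial i phi x * V x).
  apply: eq_Rintegral => x _; apply: (VE _ 0) => //.
  by rewrite scale0r addr0; exact: dphi0.
have idV := integrable_bndM mdphi hM1 iV.
have ipV := integrable_bndM mphi hM0 iV.
have iphV := integrable_bndM mphih (fun x => hM0 _) iV.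
have EA1 : \int[mu]_x (phi x * (F (U (x - h *: e)) - F (U x))) =
    \int[mu]_x ((phi (x + h *: e) - phi x) * V x).
  have pV x : phi x * F (U x) = phi x * V x.
    by apply: (VE _ 0) => //; rewrite scale0r addr0; exact: phi0.
  have phV x : phi (x + h *: e) * F (U x) = phi (x + h *: e) * V x.
    by apply: (VE (fun x => phi (x + h *: e)) h) => //; exact: phi0.
  transitivity (\int[mu]_x (phi x * F (U (x - h *: e))) - \int[mu]_x (phi x * V x)).
    rewrite -RintegralB//.
      by apply: eq_Rintegral => x _; rewrite mulrBr pV.
    have := integrable_translate (- (h *: e)) iphV.
    by apply: eq_integrable => // x _; rewrite /= -phV subrK.
  transitivity (\int[mu]_x (phi (x + h *: e) * V x) - \int[mu]_x (phi x * V x)).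
    congr (_ - _).
    rewrite -(Rintegral_translate (- (h *: e)) (f := fun x => phi (x + h *: e) * V x)).
      by apply: eq_Rintegral => x _; rewrite /translate -phV subrK.
    exact: integrable_measurable iphV.
  by rewrite -RintegralB//; apply: eq_Rintegral => x _; rewrite mulrBl.
have EA2 : `|\int[mu]_x ((phi (x + h *: e) - phi x) * V x) -
    h * \int[mu]_x (partial i phi x * V x)| <= M2 * (\int[mu]_x `|V x|) * h ^+ 2.
  have i1 : mu.-integrable setT (EFin \o (fun x => (phi (x + h *: e) - phi x) * V x)).
    have := integrableB measurableT iphV ipV.
    by apply: eq_integrable => // x _; rewrite /= mulrBl.
  have i2 : mu.-integrable setT (EFin \o (fun x => h * (partial i phi x * V x))).
    exact: (integrableZl measurableT h idV).
  have i3 : mu.-integrable setT (EFin \o (fun x => M2 * h ^+ 2 * `|V x|)).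
    exact: (integrableZl measurableT _ (integrable_abse iV)).
  rewrite -RintegralZl// -RintegralB//.
  apply: le_trans (ae_normr_Rintegral _ i3 _) _.
  - exact: (measurable_funB (integrable_measurable i1) (integrable_measurable i2)).
  - apply: aeW => x; rewrite mulrA -mulrBl normrM ler_wpM2r//.
    exact: taylor_line (ltW h0).
  - rewrite RintegralZl//; last exact: (integrable_abse iV).
    by rewrite mulrAC.
rewrite EA1 in EB.
have EP : \int[mu]_x (phi x * (F' (U x) * G x)) = \int[mu]_x (phi x * F' (U x) * G x).
  by apply: eq_Rintegral => x _; rewrite mulrA.
rewrite EP; move: EA2 EB EC.
set a := \int[mu]_x _; set b := \int[mu]_x (partial i phi x * V x).
set c := \int[mu]_x (phi x * F' (U x) * line_average i G h x).
set q := \int[mu]_x (phi x * F' (U x) * G x).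
move=> EA2 EB EC.
(* The three brackets are the errors of linearizing [F], of replacing the increment of [phi] by [h]
   times its derivative, and of replacing the increment of [U] by [h * G]. *)
rewrite (_ : h * (b + q) = (a + c) - (a - h * b) - (c - h * q)); last by ring.
apply: le_trans (ler_normB _ _) _; apply: le_trans (lerD (ler_normB _ _) (lexx _)) _.
apply: le_trans (lerD (lerD EB EA2) EC) _.
by rewrite le_eqVlt; apply/orP; left; apply/eqP; ring.
Qed.

End chain_rule.

(** * Truncation *)

Section null_set_integral.
Context d (T : measurableType d) (R : realType).
Variable mu : {measure set T -> \bar R}.
Local Open Scope ereal_scope.
Import HBNNSimple.

(** As [f] and [g] may be non-measurable, suprema over simple functions are compared: a simple
    function below [f], set to 0 on [N], lies below [g] and keeps its integral. *)
Lemma ge0_le_integral_null (N : set T) (f g : T -> \bar R) :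
  measurable N -> mu N = 0 -> (forall x, 0 <= f x) -> (forall x, 0 <= g x) ->
  (forall x, ~ N x -> f x <= g x) -> \int[mu]_x f x <= \int[mu]_x g x.
Proof.
move=> mN N0 f0 g0 fg; rewrite !ge0_integralTE//.
apply: ge_ereal_sup => _ [h hf <-].
pose h' := proj_nnsfun h (measurableC mN).
rewrite (_ : sintegral mu h = sintegral mu h').
  apply: ereal_sup_ubound; exists h' => // x.
  rewrite /h' /= mindicE; have [Nx|nNx] := pselect (N x).
    by rewrite memNset ?mulr0//; apply.
  by rewrite mem_set// mulr1; exact: le_trans (hf x) (fg x nNx).
rewrite -!integralT_nnsfun; apply: ae_eq_integral => //.
- exact/measurable_EFinP.
- exact/measurable_EFinP.
- exists N; split => // x /= hx; apply: contrapT => nNx; apply: hx => _.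
  by rewrite /h' /= mindicE mem_set// mulr1.
Qed.

End null_set_integral.

(* No measurability is assumed, so this applies to compositions with functions
   known only on a full-measure set. *)
Lemma eq_Rintegral_null d (T : measurableType d) (R : realType)
    (mu : {measure set T -> \bar R}) (D : set T) (f g : T -> R) :
  {ae mu, forall x, D x -> f x = g x} ->
  \int[mu]_(x in D) f x = \int[mu]_(x in D) g x.
Proof.
move=> [N [mN N0 fgN]].
have E x : ~ N x -> D x -> f x = g x.
  by move=> nNx; apply: contrapT => h; apply/nNx/fgN.
rewrite [LHS]Rintegral_mkcond [RHS]Rintegral_mkcond /Rintegral; congr fine.
have fg x : ~ N x -> (f \_ D) x = (g \_ D) x.
  by move=> /E h; rewrite !patchE; case: ifPn => // /set_mem.
rewrite [LHS]integralE [RHS]integralE.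
have key (f1 g1 : T -> \bar R) : (forall x, 0 <= f1 x)%E -> (forall x, 0 <= g1 x)%E ->
    (forall x, ~ N x -> f1 x = g1 x) -> (\int[mu]_x f1 x = \int[mu]_x g1 x)%E.
  move=> f0 g0 fg1; apply/eqP; rewrite eq_le; apply/andP; split.
    by apply: (ge0_le_integral_null mN N0 f0 g0) => x nNx; rewrite fg1.
  by apply: (ge0_le_integral_null mN N0 g0 f0) => x nNx; rewrite fg1.
congr (_ - _)%E; apply: key => x.
- exact: funepos_ge0.
- exact: funepos_ge0.
- by move=> nNx; rewrite !funeposE fg.
- exact: funeneg_ge0.
- exact: funeneg_ge0.
- by move=> nNx; rewrite !funenegE fg.
Qed.

Section truncation.
Context {R : realType}.
Implicit Types s a b c : R.

(** [F'] is tied to [F] by a quadratic remainder instead of a derivative: this is the form in which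
    increments of F(u) are linearized. *)
Definition lipschitz_chain (F F' : R -> R) (M L : R) :=
  [/\ measurable_fun setT F /\ measurable_fun setT F',
      forall a b, `|F b - F a| <= M * `|b - a|,
      forall a, `|F' a| <= M,
      forall a b, `|F' b - F' a| <= L * `|b - a| &
      forall a b, `|F b - F a - F' a * (b - a)| <= L * (b - a) ^+ 2].

(** The inner map is an isometry of the line, so the constants survive. *)
Lemma lipschitz_chain_affine F F' M L sigma c : `|sigma| = 1 ->
  lipschitz_chain F F' M L ->
  lipschitz_chain (fun s => F (sigma * (s - c)))
                  (fun s => sigma * F' (sigma * (s - c))) M L.
Proof.
move=> s1 [[mF mF'] h1 h2 h3 h4].
have ms : measurable_fun setT (fun s : R => sigma * (s - c)).
  by apply: measurable_funM => //; exact: measurable_funB.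
have E a b : sigma * (b - c) - sigma * (a - c) = sigma * (b - a) by ring.
have nE a b : `|sigma * (b - a)| = `|b - a| by rewrite normrM s1 mul1r.
split=> [|a b|a|a b|a b].
- split; first exact: measurableT_comp.
  by apply: measurable_funM => //; exact: measurableT_comp.
- by rewrite -(nE a b) -(E a b); exact: h1.
- by rewrite normrM s1 mul1r; exact: h2.
- by rewrite -mulrBr normrM s1 mul1r -(nE a b) -(E a b); exact: h3.
- have := h4 (sigma * (a - c)) (sigma * (b - c)); rewrite E mulrCA mulrA.
  by rewrite -[(sigma * (b - a)) ^+ 2]real_normK ?num_real// nE real_normK ?num_real.
Qed.

(* With p the positive part of s, this is p^2 / (1 + p): unlike the positive part
   it has a Lipschitz derivative, which is all that [weak_chain_rule] can handle. *)
Definition pos_smooth s : R := Num.max s 0 - 1 + (1 + Num.max s 0)^-1.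
Definition pos_smooth' s : R := 1 - (1 + Num.max s 0)^-2.

(** With [m] the positive part and [r = 1 / (1 + m)], everything follows from the increment formula
    [dr] for [r] and [0 < r <= 1]. The constant 2 bounds [r a * r b * (r a + r b)] in the increment
    of the derivative. *)
Lemma pos_smooth_chain : lipschitz_chain pos_smooth pos_smooth' 1 2.
Proof.
pose m s : R := Num.max s 0; pose r s := (1 + m s)^-1.
have m0 s : 0 <= m s by rewrite le_max lexx orbT.
have r0 s : 0 < r s by rewrite invr_gt0 ltr_pwDl.
have r1 s : r s <= 1 by rewrite invf_le1 ?ltr_pwDl// lerDl.
have dr a b : r b - r a = (m a - m b) * (r a * r b).
  by rewrite /r; field; rewrite !gt_eqF// ltr_pwDl.
have dm a b : `|m b - m a| <= `|b - a|.
  rewrite /m; case: (leP a 0) => a0; case: (leP b 0) => b0; rewrite ?subrr ?normr0//.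
  - by rewrite subr0 gtr0_norm// (le_trans _ (ler_norm _))// lerDl oppr_ge0.
  - by rewrite sub0r normrN gtr0_norm// distrC (le_trans _ (ler_norm _))// lerDl oppr_ge0.
have FE s : pos_smooth s = m s - 1 + r s by [].
have F'E s : pos_smooth' s = 1 - r s ^+ 2 by rewrite /pos_smooth' exprVn.
have rr a b : 0 <= r a * r b <= 1.
  by apply/andP; split; [exact: mulr_ge0 (ltW (r0 a)) (ltW (r0 b))|
    exact: mulr_ile1 (ltW (r0 a)) (ltW (r0 b)) (r1 a) (r1 b)].
have cm : continuous m.
  by move=> s; apply: (@continuous_max _ _ id (cst 0)) => //; exact: cst_continuous.
have mm : measurable_fun setT m by exact: continuous_measurable_fun.
have mr : measurable_fun setT r.
  apply: continuous_measurable_fun => s; apply: (@continuousV _ _ (fun s => 1 + m s)).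
    by rewrite gt_eqF// ltr_pwDl.
  by apply: continuousD; [exact: cst_continuous|exact: cm].
split=> [|a b|a|a b|a b].
- split; first by apply: measurable_funD => //; exact: measurable_funB.
  rewrite (_ : pos_smooth' = fun s => 1 - r s ^+ 2); last exact/funext.
  by apply: measurable_funB => //; exact: measurable_funX.
- rewrite !FE (_ : _ - _ = (m b - m a) + (r b - r a)); last by ring.
  rewrite dr (_ : _ + _ = (m b - m a) * (1 - r a * r b)); last by ring.
  rewrite normrM mul1r -[leRHS]mulr1 ler_pM// ger0_norm; have /andP[] := rr a b; lra.
- rewrite F'E ger0_norm; have /andP[] := rr a a; rewrite -expr2; lra.
- rewrite !F'E (_ : _ - _ = - ((r b - r a) * (r a + r b))); last by ring.
  rewrite dr normrN !normrM distrC -mulrA mulrC ler_pM//.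
  rewrite !ger0_norm ?(ltW (r0 _)) ?addr_ge0 ?(ltW (r0 _))//.
  have /andP[] := rr a b; have := r1 a; have := r1 b; have := r0 a; have := r0 b; nra.
- rewrite F'E !FE.
  rewrite (_ : _ - _ = (m b - m a) + (r b - r a) - (1 - r a ^+ 2) * (b - a));
    last by ring.
  rewrite dr; have ra0 := r0 a; have rb0 := r0 b; have ra1 := r1 a; have rb1 := r1 b.
  (* Here value and slope at [a] vanish, and the remainder is [m b ^+ 2 * r b]. *)
  have [a0|a0] := leP a 0.
    have ma : m a = 0 by rewrite /m max_r.
    have ra : r a = 1 by rewrite /r ma addr0 invr1.
    rewrite ma ra expr1n subrr mul0r subr0 sub0r mul1r.
    have : `|m b| <= `|b - a|.
      by have := dm a b; rewrite ma subr0.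
    rewrite -[X in 2 * X]real_normK ?num_real// => h.
    rewrite (_ : _ + _ = m b * (1 - r b)); last by ring.
    have -> : 1 - r b = m b * r b.
      by rewrite /r; field; rewrite gt_eqF// ltr_pwDl.
    rewrite mulrA normrM -expr2 normrX (ger0_norm (ltW rb0)).
    have := normr_ge0 (m b);
      have : `|m b| ^+ 2 <= `|b - a| ^+ 2 by rewrite ler_sqr ?nnegrE.
    have : `|m b| ^+ 2 * r b <= `|m b| ^+ 2 by rewrite ler_piMr// sqr_ge0.
    have := sqr_ge0 `|m b|; lra.
  have ma : m a = a by rewrite /m max_l// ltW.
  (* If both points are positive, the remainder is exactly [(b - a) ^+ 2 * (r a ^+ 2 * r b)]. For
     [b <= 0 < a] it is a product of two nonnegative factors, bounded by [a - b] and
     [2 * (a - b)]. *)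
  have [b0|b0] := leP b 0; last first.
    have mb : m b = b by rewrite /m max_l// ltW.
    rewrite (_ : _ - _ = (m b - m a) ^+ 2 * (r a ^+ 2 * r b)); last first.
      by rewrite /r ma mb; field; rewrite !gt_eqF//; lra.
    rewrite ma mb normrM normrX real_normK ?num_real// mulrC ler_wpM2r ?sqr_ge0//.
    rewrite ger0_norm; last by rewrite mulr_ge0 ?exprn_ge0 ?ltW.
    have : r a ^+ 2 <= 1 by rewrite expr_le1// ltW.
    have := sqr_ge0 (r a); nra.
  have mb : m b = 0 by rewrite /m max_r.
  have rb : r b = 1 by rewrite /r mb addr0 invr1.
  have e1 : 1 - r a = a * r a.
    by rewrite /r ma; field; rewrite gt_eqF// addr_gt0.
  rewrite mb rb ma sub0r subr0 mulr1.
  have e2 : 1 - r a ^+ 2 = a * r a * (1 + r a) by rewrite -[in RHS]e1; ring.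
  rewrite (_ : - a + a * r a = - (a * (a * r a))); last by rewrite -[in RHS]e1; ring.
  rewrite e2 (_ : _ - _ = a * (r a * ((1 + r a) * (a - b) - a))); last by ring.
  have ar : 0 <= a * r a by rewrite mulr_ge0// ltW.
  have ab : 0 <= (1 + r a) * (a - b) - a by nra.
  rewrite (ger0_norm (mulr_ge0 (ltW a0) (mulr_ge0 (ltW ra0) ab))).
  have : (1 + r a) * (a - b) - a <= 2 * (a - b) by nra.
  have : a * r a <= a - b by nra.
  move=> h1 h2; rewrite mulrA (_ : 2 * (b - a) ^+ 2 = (a - b) * (2 * (a - b)));
    last by ring.
  by rewrite ler_pM.
Qed.

Lemma pos_smooth_le0 s : s <= 0 -> pos_smooth s = 0.
Proof. by move=> s0; rewrite /pos_smooth max_r// addr0 invr1; ring. Qed.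

Lemma pos_smooth_gt0 s : 0 < s -> 0 < pos_smooth s.
Proof.
move=> s0; rewrite /pos_smooth max_l ?ltW//.
rewrite (_ : _ + _ = s ^+ 2 / (1 + s)); last by field; rewrite gt_eqF// addr_gt0.
by rewrite divr_gt0 ?exprn_gt0// addr_gt0.
Qed.

Lemma pos_smooth_ge0 s : 0 <= pos_smooth s.
Proof.
by have [/pos_smooth_le0 ->//|/pos_smooth_gt0/ltW] := leP s 0.
Qed.

Lemma pos_smooth'_ge0 s : 0 <= pos_smooth' s.
Proof.
rewrite /pos_smooth' subr_ge0 invf_le1 ?exprn_gt0 ?ltr_pwDl ?le_max ?lexx ?orbT//.
by rewrite exprn_ege1// lerDl le_max lexx orbT.
Qed.

End truncation.

(** * L^2 on a bounded open set and the chain rule in H^1 *)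

Section L2_spaces.
Context {R : realType} {d : nat}.
Local Notation Rd := 'rV[R]_d.
Local Notation mu := (lebesgue_rV d).
Variable O : set Rd.
Hypothesis oO : open O.
Hypothesis bO : bounded_set O.
Implicit Types (u v : Rd -> R).

Let mO : measurable O := open_measurable_rV oO.

Lemma bounded_lebesgue_lty : (mu O < +oo)%E.
Proof.
have [N [_ ON]] := bO.
apply: (@le_lt_trans _ _ (mu (box (const_mx (- (`|N| + 2))) (const_mx (`|N| + 2) : Rd)))).
  apply: le_measure; [exact: mem_set|by apply: mem_set; exact: measurable_box|].
  move=> x Ox j; rewrite !mxE -ltr_norml.
  have : `|x| <= `|N| + 1 by apply: (ON (`|N| + 1)) => //; rewrite ltr_pwDr// ler_norm.
  move=> xN; apply: (@le_lt_trans _ _ `|x|);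
    last by rewrite (le_lt_trans xN)// ltrD2l ltr1n.
  rewrite [leRHS]/Num.norm /= mx_normrE.
  by apply/bigmax_geP; right => /=; exists (0, j).
exact: lebesgue_rV_box_lty.
Qed.

Lemma integrable_cst_bounded (k : R) : mu.-integrable O (EFin \o cst k).
Proof.
apply: measurable_bounded_integrable => //; first exact: bounded_lebesgue_lty.
by exists `|k|; split => // M kM x _ /=; exact: ltW.
Qed.

Lemma le_integrable_on u v : measurable_fun O u ->
  (forall x, O x -> `|u x| <= v x) -> mu.-integrable O (EFin \o v) ->
  mu.-integrable O (EFin \o u).
Proof.
move=> mu' uv iv; apply: le_integrable iv => //; first exact/measurable_EFinP.
by move=> x Ox; rewrite /= lee_fin (le_trans (uv x Ox))// ler_norm.
Qed.

Lemma L2_integrableM u v : L2 O u -> L2 O v ->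
  mu.-integrable O (EFin \o (fun x => u x * v x)).
Proof.
move=> [mu' iu] [mv iv].
apply: (@le_integrable_on _ (fun x => u x ^+ 2 + v x ^+ 2)).
- exact: measurable_funM.
- move=> x _;
  rewrite normrM -(real_normK (num_real (u x))) -(real_normK (num_real (v x))).
  have := sqr_ge0 (`|u x| - `|v x|); have := normr_ge0 (u x); have := normr_ge0 (v x).
  have := sqr_ge0 (`|u x| + `|v x|); nra.
- exact: (integrableD mO iu iv).
Qed.

Lemma L2_cst (k : R) : L2 O (fun=> k).
Proof. by split => //; exact: (integrable_cst_bounded (k ^+ 2)). Qed.

Lemma L2_le u v : measurable_fun O u -> (forall x, O x -> `|u x| <= v x) ->
  L2 O v -> L2 O u.
Proof.
move=> mu' uv [mv iv]; split => //.
apply: (le_integrable_on _ _ iv); first exact: measurable_funX.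
move=> x Ox; rewrite normrX lerXn2r ?nnegrE ?(le_trans _ (uv x Ox))//.
Qed.

Lemma L2Z (k : R) u : L2 O u -> L2 O (fun x => k * u x).
Proof.
move=> [mu' iu]; split; first exact: measurable_funM.
have := integrableZl mO (k ^+ 2) iu.
by apply: eq_integrable => // x _; rewrite /= exprMn.
Qed.

Lemma L2D u v : L2 O u -> L2 O v -> L2 O (fun x => u x + v x).
Proof.
move=> [mu' iu] [mv iv]; split; first exact: measurable_funD.
apply: (@le_integrable_on _ (fun x => 2 * (u x ^+ 2 + v x ^+ 2))).
- by apply: measurable_funX; exact: measurable_funD.
- move=> x _; rewrite ger0_norm ?sqr_ge0//.
  by have := sqr_ge0 (u x - v x); nra.
- exact: (integrableZl mO 2 (integrableD mO iu iv)).
Qed.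

Lemma L2_norm u : L2 O u -> L2 O (fun x => `|u x|).
Proof.
move=> [mu' iu]; split; first exact: measurableT_comp.
by apply: eq_integrable iu => // x _; rewrite /= real_normK ?num_real.
Qed.

Lemma L2_bndM (b : Rd -> R) (C : R) u : measurable_fun O b ->
  (forall x, O x -> `|b x| <= C) -> L2 O u -> L2 O (fun x => b x * u x).
Proof.
move=> mb bC Lu; have [mu' _] := Lu.
apply: L2_le (L2Z C (L2_norm Lu)); first exact: measurable_funM.
by move=> x Ox; rewrite normrM ler_wpM2r// bC.
Qed.

Lemma L2_integrable u : L2 O u -> mu.-integrable O (EFin \o u).
Proof.
move=> Lu; have := L2_integrableM Lu (L2_cst 1).
by apply: eq_integrable => // x _; rewrite /= mulr1.
Qed.

(** [weak_chain_rule] is applied to the extensions of [u] and [g] by zero. These may jump across the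
    boundary, which is harmless because only test functions supported inside [O] occur. Boundedness
    of [O] puts the constant [F 0] in L^2. *)
Lemma H1_grad_chain (u : Rd -> R) (g : 'I_d -> Rd -> R) (F F' : R -> R) (M L : R) :
  lipschitz_chain F F' M L -> H1_grad O u g ->
  H1_grad O (fun x => F (u x)) (fun i x => F' (u x) * g i x).
Proof.
move=> [[mF mF'] F_lip F'_le F'_lip F_taylor] [Lu Hg]; have [mu' iu2] := Lu.
have mFu : measurable_fun O (fun x => F (u x)) by exact: measurableT_comp.
have mF'u : measurable_fun O (fun x => F' (u x)) by exact: measurableT_comp.
split.
  apply: (L2_le mFu _ (L2D (L2_cst `|F 0|) (L2Z M (L2_norm Lu)))) => x _.
  rewrite -[F (u x)](subrK (F 0)) (le_trans (ler_normD _ _))//.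
  by rewrite addrC lerD2l; have := F_lip 0 (u x); rewrite subr0.
move=> i; have [Lg wg] := Hg i; have [mg ig2] := Lg.
split; first exact: L2_bndM Lg.
move=> phi tphi.
have [sphi [K [cK KO phi0]]] := tphi.
pose U := u \_ O; pose G := g i \_ O.
have restr f : mu.-integrable O (EFin \o f) -> mu.-integrable setT (EFin \o (f \_ O)).
  by move=> /(integrable_mkcond _ mO); rewrite restrict_EFin.
have iU := restr _ (L2_integrable Lu).
have iG := restr _ (L2_integrable Lg).
have iG2 : mu.-integrable setT (EFin \o (fun x => G x ^+ 2)).
  have := restr _ ig2; apply: eq_integrable => // x _.
  by rewrite /= /G !patchE; case: ifP; rewrite ?expr0n.
have innerE (f psi : Rd -> R) :
    inner O f psi = \int[mu]_x (psi x * (f \_ O) x).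
  rewrite /inner Rintegral_mkcond; apply: eq_Rintegral => x _.
  by rewrite !patchE; case: ifP; rewrite ?mulr0// mulrC.
have weakUG psi : test_function O psi ->
    \int[mu]_x (partial i psi x * U x) = - \int[mu]_x (psi x * G x).
  by move=> tpsi; rewrite -!innerE; exact: wg.
have := weak_chain_rule oO iU iG iG2 weakUG mF mF' F_lip F'_le F'_lip F_taylor tphi.
have dphi0 := partial_support i cK phi0.
(* Outside [O] the two integrands differ by the value [F 0], but the derivative of [phi] vanishes
   there. *)
rewrite !innerE => E; transitivity (\int[mu]_x (partial i phi x * F (U x))).
  apply: eq_Rintegral => x _; rewrite /U !patchE; case: ifPn => // /negP xO.
  by rewrite dphi0 ?mul0r// => /KO Ox; apply: xO; exact/mem_set.
rewrite E; congr (- _); apply: eq_Rintegral => x _; rewrite /U /G !patchE.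
by case: ifPn => // _; rewrite mulr0.
Qed.

End L2_spaces.

(** * The Peng-Robinson coefficients *)

Lemma continuous_at_comp (R : realType) (f g : R -> R) (c : R) :
  {for c, continuous f} -> {for f c, continuous g} ->
    {for c, continuous (fun x => g (f x))}.
Proof. by move=> cf cg; exact: (@continuous_comp _ _ _ f g c cf cg). Qed.

Section peng_robinson_continuity.
Context {R : realType}.
Variables (Rgas temp alpha beta lambda vartheta : R).
Hypothesis lambda_gt0 : 0 < lambda.
Hypothesis beta_gt0 : 0 < beta.

Let S c := (0 < c) && (beta * c < 1).
Let P c := lambda * c - c * ln (1 - beta * c).
Let dP c := lambda - ln (1 - beta * c) + c * (beta / (1 - beta * c)).

Let id_cont (c : R) : {for c, continuous (fun x : R => x)}. Proof. by []. Qed.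

Let cst_cont (k c : R) : {for c, continuous (fun _ : R => k)}.
Proof. exact: cst_continuous. Qed.

Let D_cont (f g : R -> R) (c : R) : {for c, continuous f} -> {for c, continuous g} ->
  {for c, continuous (fun x : R => f x + g x : R)}.
Proof. by move=> cf cg; exact: (continuousD cf cg). Qed.

Let M_cont (f g : R -> R) (c : R) : {for c, continuous f} -> {for c, continuous g} ->
  {for c, continuous (fun x : R => f x * g x : R)}.
Proof. by move=> cf cg; exact: (continuousM cf cg). Qed.

Let N_cont (f : R -> R) (c : R) : {for c, continuous f} ->
  {for c, continuous (fun x : R => - f x : R)}.
Proof. by move=> cf; exact: (continuousN cf). Qed.

Let V_cont (f : R -> R) (c : R) : f c != 0 -> {for c, continuous f} ->
  {for c, continuous (fun x : R => (f x)^-1 : R)}.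
Proof. by move=> f0 cf; exact: (continuousV f0 cf). Qed.

Let ln_cont (f : R -> R) (c : R) : 0 < f c -> {for c, continuous f} ->
  {for c, continuous (fun x : R => ln (f x) : R)}.
Proof. by move=> f0 cf; apply: continuous_at_comp => //; exact: continuous_ln. Qed.

Let sqrt_cont (f : R -> R) (c : R) : {for c, continuous f} ->
  {for c, continuous (fun x : R => Num.sqrt (f x) : R)}.
Proof. by move=> cf; apply: continuous_at_comp => //; exact: sqrt_continuous. Qed.

(** The logarithm is nonpositive on [S], so [lambda > 0] keeps the radicand away from 0, where the
    square root is not differentiable. *)
Let P_gt0 c : S c -> 0 < P c.
Proof.
move=> /andP[c0 bc]; rewrite /P -mulrC -mulrBr mulr_gt0// subr_gt0.
by rewrite (le_lt_trans _ lambda_gt0)// ln_le0// lerBlDr lerDl mulr_ge0// ltW.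
Qed.

Let is_derive_P c : S c -> is_derive c 1 P (dP c).
Proof.
move=> /andP[c0 bc].
have d1 : is_derive c 1 (fun x : R => 1 - beta * x) (- beta).
  by apply: is_derive_eq; rewrite /GRing.scale /= ?add0r ?mul1r mulr1.
have d2 : is_derive (1 - beta * c) 1 (@ln R) (1 - beta * c)^-1.
  by apply: is_derive1_ln; rewrite subr_gt0.
have d3 := @is_derive1_comp _ (@ln R) (fun x => 1 - beta * x) c _ _ d2 d1.
have d4 : is_derive c 1 (fun x : R => x) (1 : R) by exact: is_derive_id.
have d5 : is_derive c 1 (fun x : R => lambda * x) lambda.
  by apply: is_derive_eq; rewrite /GRing.scale /= ?add0r ?mul1r mulr1.
have := is_deriveB d5 (is_deriveM d4 d3).
move/(@is_derive_eq _ _ _ _ _ _ _ _); apply.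
by rewrite /dP /GRing.scale /=; ring.
Qed.

Let openS c : S c -> \forall c' \near c, S c'.
Proof.
move=> /andP[c0 bc]; have bc' : c < beta^-1 by rewrite -[beta^-1]mulr1 ltr_pdivlMl.
near=> x; apply/andP; split; first by near: x; exact: lt_nbhsr.
rewrite -ltr_pdivlMl// mulr1; near: x; exact: lt_nbhsl.
Unshelve. all: by end_near. Qed.

Let dG c : S c -> derive1 (G_fun beta lambda) c = (2 * Num.sqrt (P c))^-1 * dP c.
Proof.
move=> Sc; have P0 := P_gt0 Sc.
have := @is_derive1_comp _ (@Num.sqrt R) P c _ _ (is_derive1_sqrt P0) (is_derive_P Sc).
by rewrite derive1E => -[_ <-].
Qed.

Let P_cont c : S c -> {for c, continuous P}.
Proof.
move=> /andP[c0 bc]; apply: D_cont; first exact: M_cont.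
apply: N_cont; apply: M_cont => //; apply: ln_cont; first by rewrite subr_gt0.
by apply: D_cont => //; apply: N_cont; exact: M_cont.
Qed.

Let G_cont c : S c -> {for c, continuous (G_fun beta lambda)}.
Proof. by move=> Sc; apply: sqrt_cont; exact: P_cont. Qed.

(** [derive1] is given by a formula only on [S]; since [S] is open, the formula holds near [c] and
    its continuity transfers. *)
Let dG_cont c : S c -> {for c, continuous (derive1 (G_fun beta lambda))}.
Proof.
move=> Sc; have /andP[c0 bc] := Sc; have P0 := P_gt0 Sc.
have E : \forall x \near c, (2 * Num.sqrt (P x))^-1 * dP x = derive1 (G_fun beta lambda) x.
  by apply: filterS (openS Sc) => x Sx; rewrite dG.
have bc' : 1 - beta * c != 0 by rewrite gt_eqF// subr_gt0.
change (derive1 (G_fun beta lambda) x @[x --> c] --> derive1 (G_fun beta lambda) c).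
rewrite (dG Sc); apply: cvg_trans (near_eq_cvg E) _.
change {for c, continuous (fun x => (2 * Num.sqrt (P x))^-1 * dP x)}.
have c1 : {for c, continuous (fun x => 1 - beta * x)}.
  by apply: D_cont => //; apply: N_cont; exact: M_cont.
apply: M_cont.
  apply: V_cont; first by rewrite mulf_neq0 ?gt_eqF// sqrtr_gt0.
  by apply: M_cont => //; apply: sqrt_cont; exact: P_cont.
apply: D_cont.
  by apply: D_cont => //; apply: N_cont; apply: ln_cont => //; rewrite subr_gt0.
by apply: M_cont => //; apply: M_cont => //; exact: V_cont.
Qed.

Lemma nu_continuous c : 0 < c -> beta * c < 1 ->
  {for c, continuous (nu_fun Rgas temp beta lambda)}.
Proof.
move=> c0 bc; have Sc : S c by rewrite /S c0.
apply: M_cont => //; apply: D_cont; first by apply: V_cont => //; rewrite gt_eqF.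
by apply: M_cont; exact: dG_cont.
Qed.

Lemma nu_ge0 c : 0 <= Rgas -> 0 <= temp -> 0 < c -> 0 <= nu_fun Rgas temp beta lambda c.
Proof.
move=> r0 t0 c0; rewrite mulr_ge0 ?mulr_ge0// addr_ge0 ?sqr_ge0// invr_ge0 ltW//.
Qed.

Lemma sr_continuous c : 0 < c -> beta * c < 1 ->
  {for c, continuous (sr_fun Rgas temp alpha beta lambda vartheta)}.
Proof.
move=> c0 bc; have Sc : S c by rewrite /S c0.
have bc0 : 0 < beta * c by rewrite mulr_gt0.
(* The crude bounds 1 and 2 on the root suffice for the argument of the logarithm: since
   [beta * c < 1], its numerator exceeds 0. *)
have s2 : (1 : R) <= Num.sqrt 2 by rewrite -[leLHS]sqrtr1 ler_sqrt// ler1n.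
have s2' : Num.sqrt 2 <= 2 :> R.
  by rewrite -[leRHS]ger0_norm// -sqrtr_sqr ler_wsqrtr// -natrX ler_nat.
apply: D_cont.
  apply: D_cont.
    apply: D_cont => //; apply: N_cont; apply: M_cont => //; exact: ln_cont.
  apply: M_cont => //; apply: D_cont => //; apply: D_cont.
    by apply: M_cont => //; apply: M_cont; exact: dG_cont.
  apply: N_cont; apply: M_cont; last exact: dG_cont.
  by apply: M_cont => //; exact: G_cont.
apply: N_cont; apply: D_cont.
  apply: M_cont => //; apply: ln_cont.
    apply: divr_gt0; nra.
  apply: M_cont.
    by apply: D_cont => //; apply: M_cont => //; exact: M_cont.
  apply: V_cont; first by rewrite gt_eqF//; nra.
  by apply: D_cont => //; apply: M_cont => //; exact: M_cont.
apply: N_cont; apply: M_cont; first exact: M_cont.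
apply: V_cont; first by rewrite gt_eqF//; nra.
apply: D_cont; first by apply: D_cont => //; exact: M_cont.
by apply: N_cont; apply: M_cont; exact: M_cont.
Qed.

End peng_robinson_continuity.

Section clamp.
Context {R : realType}.
Variables (cm cM : R).
Hypothesis cmM : cm <= cM.

Definition clamp (t : R) : R := Num.max cm (Num.min cM t).

Lemma clamp_itv t : cm <= clamp t <= cM.
Proof. by rewrite /clamp le_max lexx/= ge_max cmM ge_min lexx. Qed.

Lemma clamp_id t : cm <= t <= cM -> clamp t = t.
Proof. by move=> /andP[h1 h2]; rewrite /clamp min_r// max_r. Qed.

(** Composition with the continuous retraction [clamp] makes [f] continuous on the whole line, with
    the values it takes on the compact interval. This supplies bounded measurable coefficients. *)
Lemma clamp_regular (f : R -> R) :
  (forall c, cm <= c <= cM -> {for c, continuous f}) ->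
  measurable_fun setT (f \o clamp) /\ exists C, forall t, `|f (clamp t)| <= C.
Proof.
move=> cf.
have cc : continuous clamp.
  move=> t; apply: (@continuous_max _ _ (cst cm)); first exact: cst_continuous.
  by apply: (@continuous_min _ _ (cst cM)); [exact: cst_continuous|].
split.
  apply: continuous_measurable_fun => t.
  apply: continuous_comp; [exact: cc|exact/cf/clamp_itv].
have cnf : {within `[cm, cM], continuous (fun x => `|f x|)}.
  apply: continuous_in_subspaceT => x /set_mem /=; rewrite in_itv /= => /cf cfx.
  by apply: continuous_comp => //; exact: norm_continuous.
have [c _ hc] := EVT_max cmM cnf.
by exists `|f c| => t; apply: hc; rewrite in_itv /= clamp_itv.
Qed.

End clamp.

(** * Comparison with constants *)

Lemma pos_smoothM_ge0 (R : realType) (s : R) : 0 <= s * pos_smooth s.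
Proof.
have [s0|s0] := leP s 0; first by rewrite pos_smooth_le0// mulr0.
by rewrite mulr_ge0 ?pos_smooth_ge0 ?ltW.
Qed.

Lemma pos_smoothM_eq0 (R : realType) (s : R) : s * pos_smooth s = 0 -> s <= 0.
Proof.
move=> h; rewrite leNgt; apply/negP => s0; move: h; apply/eqP.
by rewrite mulf_neq0// gt_eqF// pos_smooth_gt0.
Qed.

Lemma ae_eq0_Rintegral_le0 d (T : measurableType d) (R : realType)
    (mu : {measure set T -> \bar R}) (D : set T) (f : T -> R) : measurable D ->
  mu.-integrable D (EFin \o f) -> (forall x, D x -> 0 <= f x) ->
  \int[mu]_(x in D) f x <= 0 -> {ae mu, forall x, D x -> f x = 0}.
Proof.
move=> mD intf f0 le0.
have mf := measurable_int _ intf.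
suff : ae_eq mu D (EFin \o f) (cst 0%E).
  by apply: filterS => x h Dx; have := h Dx; rewrite /= => -[].
apply/(ae_eq_integral_abs mu mD mf).
rewrite (eq_integral (EFin \o f)); last first.
  by move=> x /set_mem Dx; rewrite /= ger0_norm// f0.
rewrite -[LHS]fineK; last exact: (integrable_fin_num mD intf).
congr EFin; apply/eqP; rewrite eq_le le0/=.
by apply: fine_ge0; apply: integral_ge0 => x Dx; rewrite lee_fin f0.
Qed.

Section comparison.
Context {R : realType} {d : nat}.
Local Notation Rd := 'rV[R]_d.
Local Notation mu := (lebesgue_rV d).
Variables (O : set Rd) (tau kappa mue : R) (u cn n r : Rd -> R) (g : 'I_d -> Rd -> R).
Hypothesis oO : open O.
Hypothesis bO : bounded_set O.
Hypothesis tau_gt0 : 0 < tau.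
Hypothesis kappa_gt0 : 0 < kappa.
Hypothesis ug : H1_grad O u g.
Hypothesis mn : measurable_fun O n.
Hypothesis mr : measurable_fun O r.
Variables (Cn Cr : R).
Hypothesis n_le : forall x, O x -> `|n x| <= Cn.
Hypothesis r_le : forall x, O x -> `|r x| <= Cr.
Hypothesis Lcn : L2 O cn.
Hypothesis n_ge0 : forall x, O x -> 0 <= n x.
Hypothesis weak : forall w h, H1_grad O w h ->
  tau^-1 * inner O (u \- cn) w + kappa * inner_grad O g h
    + inner O (fun x => n x * u x) w = inner O (fun x => r x + mue) w.

(* [sigma = 1] yields upper bounds and [sigma = -1] lower bounds. *)
Lemma weak_comparison (sigma c : R) : `|sigma| = 1 ->
  (forall x, O x -> 0 <= sigma * (c - cn x)) ->
  (forall x, O x -> 0 <= sigma * (c * n x - r x - mue)) ->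
  {ae mu, forall x, O x -> sigma * (u x - c) <= 0}.
Proof.
move=> s1 hcn hr; have mO := open_measurable_rV oO.
have Hw := H1_grad_chain oO bO (lipschitz_chain_affine c s1 pos_smooth_chain) ug.
set w := fun x => pos_smooth (sigma * (u x - c)) in Hw.
have [Lw _] := Hw; have [Lu _] := ug.
have w0 x : 0 <= w x by exact: pos_smooth_ge0.
have ss : sigma * sigma = 1.
  by rewrite -expr2 -(real_normK (num_real sigma)) s1 expr1n.
have Luc : L2 O (u \- cn).
  have := L2D oO Lu (L2Z oO (-1) Lcn).
  rewrite (_ : (fun _ => _) = u \- cn)//.
  by apply/funext => x /=; rewrite mulN1r.
have Lnu := L2_bndM oO mn n_le Lu.
have Lr : L2 O (fun x => r x + mue).
  apply: (L2_le oO _ _ (L2_cst oO bO (Cr + `|mue|))).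
    exact: measurable_funD.
  by move=> x Ox; rewrite (le_trans (ler_normD _ _))// lerD2r r_le.
have i1 := L2_integrableM oO Luc Lw.
have i2 := L2_integrableM oO Lnu Lw.
have i3 := L2_integrableM oO Lr Lw.
(* All terms of the tested equation except the gradient term. Its integral is minus [kappa] times
   that of [pos_smooth'] times the squared gradient, the two signs [sigma] cancelling. *)
pose I x := sigma * (tau^-1 * ((u x - cn x) * w x) + n x * u x * w x - (r x + mue) * w x).
have i4 : mu.-integrable O (EFin \o (fun x => tau^-1 * ((u x - cn x) * w x))).
  exact: (integrableZl mO tau^-1 i1).
have i5 : mu.-integrable O (EFin \o (fun x => tau^-1 * ((u x - cn x) * w x) + n x * u x * w x)).
  exact: (integrableD mO i4 i2).
have i6 : mu.-integrable O (EFin \o (fun x =>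
    tau^-1 * ((u x - cn x) * w x) + n x * u x * w x - (r x + mue) * w x)).
  exact: (integrableB mO i5 i3).
have iI : mu.-integrable O (EFin \o I) by exact: (integrableZl mO sigma i6).
have I0 : \int[mu]_(x in O) I x <= 0.
  rewrite /I RintegralZl// RintegralB// RintegralD// RintegralZl//.
  have := weak Hw; rewrite /inner_grad /inner => <-.
  rewrite (_ : sigma * _ = - (kappa * (sigma * \sum_(i < d)
    \int[mu]_(x in O) (g i x * (sigma * pos_smooth' (sigma * (u x - c)) * g i x)))));
      last by ring.
  rewrite oppr_le0 mulr_ge0 ?(ltW kappa_gt0)// mulr_sumr sumr_ge0// => i _.
  have [_ /(_ i)[Lh _]] := Hw; have [_ /(_ i)[Lg _]] := ug.
  rewrite -RintegralZl//; last exact: L2_integrableM.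
  apply: Rintegral_ge0 => x _.
  rewrite (_ : _ * _ = sigma * sigma * (pos_smooth' (sigma * (u x - c)) * g i x ^+ 2));
    last by ring.
  by rewrite ss mul1r mulr_ge0 ?sqr_ge0 ?pos_smooth'_ge0.
pose z x := sigma * (u x - c).
(* Substituting u = c + (u - c) leaves three further terms, nonnegative by the sign of
   [sigma * (c - cn x)], by [n_ge0], and by the condition on [mue]. *)
have zI x : O x -> tau^-1 * (z x * w x) <= I x.
  move=> Ox; rewrite -subr_ge0 (_ : _ - _ = tau^-1 * (sigma * (c - cn x) * w x) +
     n x * (z x * w x) + sigma * (c * n x - r x - mue) * w x); last by rewrite /I /z;
       ring.
  rewrite addr_ge0//; last by rewrite mulr_ge0// hr.
  rewrite addr_ge0//;
    first by rewrite mulr_ge0 ?invr_ge0 ?(ltW tau_gt0)// mulr_ge0// hcn.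
  by rewrite mulr_ge0 ?n_ge0//; exact: pos_smoothM_ge0.
have zw0 x : 0 <= tau^-1 * (z x * w x).
  by rewrite mulr_ge0 ?invr_ge0 ?(ltW tau_gt0)//; exact: pos_smoothM_ge0.
have mzw : measurable_fun O (fun x => tau^-1 * (z x * w x)).
  have [mu' _] := Lu; have [mw _] := Lw.
  apply: measurable_funM => //; apply: measurable_funM => //.
  by apply: measurable_funM => //; exact: measurable_funB.
have izw : mu.-integrable O (EFin \o (fun x => tau^-1 * (z x * w x))).
  apply: (le_integrable_on oO mzw _ iI) => x Ox.
  by rewrite ger0_norm// zI.
have := ae_eq0_Rintegral_le0 mO izw (fun x _ => zw0 x) (le_trans (le_Rintegral mO izw iI zI) I0).
apply: filterS => x h Ox; apply: pos_smoothM_eq0.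
have /eqP := h Ox; rewrite mulf_eq0 invr_eq0 (gt_eqF tau_gt0) /= => /eqP; exact.
Qed.

End comparison.

(** * Bounds for the Peng-Robinson scheme *)

Theorem theorem4p2 (R : realType) (d : nat) (Omega : set 'rV[R]_d)
    (tau kappa ct vartheta Rgas temp Tc Pc omega lambda cm cM eps : R)
    (cn cn1 : 'rV[R]_d -> R) (mue : R) :
  let alpha := pr_alpha Rgas temp Tc Pc omega in
  let beta := pr_beta Rgas Tc Pc in
  let nu := nu_fun Rgas temp beta lambda in
  let sr := sr_fun Rgas temp alpha beta lambda vartheta in
  (0 < d)%N -> smooth_bounded_domain Omega ->
  0 < tau -> 0 < kappa -> 0 < ct -> 0 < Rgas -> 0 < temp -> 0 < Tc -> 0 < Pc ->
  measurable_fun Omega cn ->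
  {ae lebesgue_rV d, forall x, Omega x -> cm <= cn x <= cM} ->
  0 < cm -> cm <= cM -> beta * cM <= eps -> eps < 1 ->
  0 < lambda ->
  lambda >= eps / (1 - eps) ^+ 2
    + Num.sqrt (eps ^+ 2 / (1 - eps) ^+ 4
                - 2 * ln (1 - eps) * (eps / (1 - eps) ^+ 2)) ->
  weak_solution Omega tau kappa ct nu sr cn cn1 mue ->
  (ereal_sup [set (cm * nu c - sr c)%:E | c in `[cm, cM]] <= mue%:E)%E ->
  (mue%:E <= ereal_inf [set (cM * nu c - sr c)%:E | c in `[cm, cM]])%E ->
  {ae lebesgue_rV d, forall x, Omega x -> cm <= cn1 x <= cM}.
Proof.
move=> alpha beta nu sr _ [_ oO _ bO _] tau0 kappa0 _ R0 T0 Tc0 Pc0 mcn cn_itv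
  cm0 cmM bcM eps1 lambda0 _ [g [ug _ weak]] mue_sup mue_inf.
have beta0 : 0 < beta.
  apply: mulr_gt0; last by rewrite divr_gt0// mulr_gt0.
  by apply: divr_gt0; [rewrite ltr0n|apply: exprn_gt0; rewrite ltr0n].
have bc c : cm <= c <= cM -> beta * c < 1.
  move=> /andP[_ ccM]; apply: le_lt_trans eps1; apply: le_trans bcM.
  by rewrite ler_pM2l.
have c_gt0 c : cm <= c <= cM -> 0 < c by move=> /andP[cmc _]; exact: lt_le_trans cmc.
have [mnu [Cnu nu_le]] : measurable_fun setT (nu \o clamp cm cM) /\
    exists C, forall t, `|nu (clamp cm cM t)| <= C.
  by apply: clamp_regular => // c hc; apply: nu_continuous => //;
    [exact: c_gt0|exact: bc].
have [msr [Csr sr_le]] : measurable_fun setT (sr \o clamp cm cM) /\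
    exists C, forall t, `|sr (clamp cm cM t)| <= C.
  by apply: clamp_regular => // c hc; apply: sr_continuous => //;
    [exact: c_gt0|exact: bc].
have [mid _] : measurable_fun setT (id \o clamp cm cM) /\
    exists C, forall t, `|id (clamp cm cM t)| <= C.
  by apply: clamp_regular => // c hc; exact: id.
(* A representative of [cn] lying in the interval at every point, since [weak_comparison] asks for
   its conditions pointwise. *)
pose c' x := clamp cm cM (cn x).
have c'E : {ae lebesgue_rV d, forall x, Omega x -> cn x = c' x}.
  by apply: filterS cn_itv => x h Ox; rewrite /c' clamp_id// h.
have c'_itv x : cm <= c' x <= cM by exact: clamp_itv.
have mcomp (f : R -> R) : measurable_fun setT (f \o clamp cm cM) ->
    measurable_fun Omega (fun x => f (c' x)).
  by move=> mf; exact: (measurableT_comp mf mcn).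
have Lc' : L2 Omega c'.
  apply: (L2_le oO _ _ (L2_cst oO bO cM)); first exact: (mcomp id).
  by move=> x _; have /andP[h1 h2] := c'_itv x;
    rewrite ger0_norm// (le_trans (ltW cm0)).
have weak' w h : H1_grad Omega w h ->
    tau^-1 * inner Omega (cn1 \- c') w + kappa * inner_grad Omega g h
      + inner Omega (fun x => nu (c' x) * cn1 x) w
    = inner Omega (fun x => sr (c' x) + mue) w.
  (* Measurability of [nu (cn x)] and [sr (cn x)] is unknown where [cn x] leaves the interval, hence
     the exchange through [eq_Rintegral_null]. *)
  move=> Hw; have := weak w h Hw.
  rewrite /inner.
  rewrite (eq_Rintegral_null (f := fun x => (cn1 \- cn) x * w x) (g := fun x => (cn1 \- c') x * w x)).
    rewrite (eq_Rintegral_null (f := fun x => nu (cn x) * cn1 x * w x) (g := fun x => nu (c' x) * cn1 x * w x)).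
      rewrite (eq_Rintegral_null (f := fun x => (sr (cn x) + mue) * w x) (g := fun x => (sr (c' x) + mue) * w x))//.
      by apply: filterS c'E => x E Ox; rewrite -E.
    by apply: filterS c'E => x E Ox; rewrite -E.
  by apply: filterS c'E => x E Ox; rewrite /= -E.
have cmp := weak_comparison oO bO tau0 kappa0 ug (mcomp _ mnu) (mcomp _ msr)
  (fun x _ => nu_le (cn x)) (fun x _ => sr_le (cn x)) Lc'
  (fun x _ => nu_ge0 beta lambda (ltW R0) (ltW T0) (c_gt0 _ (c'_itv x))) weak'.
(* The minimum condition, read at [c' x], makes [cM * nu - sr - mue] nonnegative. *)
have upper : {ae lebesgue_rV d, forall x, Omega x -> 1 * (cn1 x - cM) <= 0}.
  apply: cmp => [|x _|x _]; first by rewrite normr1.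
    by rewrite mul1r subr_ge0; have /andP[] := c'_itv x.
  rewrite mul1r subr_ge0 -lee_fin; apply: le_trans mue_inf _.
  by apply: ereal_inf_lbound; exists (c' x) => //=; rewrite in_itv /= c'_itv.
(* The maximum condition makes [cm * nu - sr - mue] nonpositive, and [sigma = -1] reverses the
   sign. *)
have lower : {ae lebesgue_rV d, forall x, Omega x -> -1 * (cn1 x - cm) <= 0}.
  apply: cmp => [|x _|x _]; first by rewrite normrN1.
    by rewrite mulN1r opprB subr_ge0; have /andP[] := c'_itv x.
  rewrite mulN1r opprB subr_ge0 -lee_fin; apply: le_trans mue_sup.
  by apply: ereal_sup_ubound; exists (c' x) => //=; rewrite in_itv /= c'_itv.
apply: filterS2 upper lower => x hu hl Ox.
have := hu Ox; have := hl Ox; rewrite mul1r mulN1r oppr_le0 subr_ge0 subr_le0.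
by move=> -> ->.
Qed.
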